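(* There exist an unbounded complete $2$-PI space $(X,d,\omega)$, a ball $B_0\subset X$, and a compact set $K\subset B_0$ such that $$\mathcal H_{0,\omega}(K;B_0)>0\qquad\text{and}\qquad\operatorname{cap}_{2,\omega}(K;\Lambda_0B_0)=0.$$
   Context: Balls are open and carry a designated centre and radius; $\lambda B$ is the concentric dilate; $r_B$ is the radius of $B$; $u_{B,\omega}=\frac1{\omega(B)}\int_B u\,d\omega$. The measure $\omega$ is a Borel regular measure with full support on the metric space $(X,d)$. $2$-PI space: $\omega$ is doubling, i.e. $0<\omega(B(x,2r))\le C_D\,\omega(B(x,r))<\infty$ for all $x\in X$, $r>0$, and there are $C_P>0$, $\lambda_P\ge1$ such that $$\frac1{\omega(B)}\int_B|u-u_{B,\omega}|\,d\omega\le C_P r_B\Big(\frac1{\omega(\lambda_PB)}\int_{\lambda_PB}g^2\,d\omega\Big)^{1/2}$$ for every ball $B$, every locally integrable $u$ and every $2$-weak upper gradient $g$ of $u$. For $B_0=B(x_0,R)$ and $K\subset B_0$, $\mathcal H_{0,\omega}(K;B_0)=\inf\sum_i\omega(B_i)/r_i^2$, the infimum being over countable families of balls $B_i=B(x_i,r_i)$ with $K\subset\bigcup_iB_i$, $x_i\in B_0$, $0<r_i\le R$ (this is the endpoint $\delta=0$ of the content $\inf\sum_i(r_i/R)^\delta\omega(B_i)/r_i^2$). For $\Omega$ open and $K\subset\Omega$, $\operatorname{cap}_{2,\omega}(K;\Omega)=\inf\{\int_\Omega g_v^2\,d\omega: v\in N_0^{1,2}(\Omega),\ \widetilde v\ge1\text{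 quasieverywhere on }K\}$, where $N_0^{1,2}(\Omega)$ is the Newtonian space with zero boundary values, $g_v$ the minimal $2$-weak upper gradient and $\widetilde v$ a quasicontinuous representative. $\Lambda_0$ is a fixed dilation with $\Lambda_0>8\lambda_2+8$, where $\lambda_2\ge1$ (depending only on the $2$-PI data) is such that $\int_B|u-u_{B,\omega}|^2\,d\omega\le C_2'r_B^2\int_{\lambda_2B}g_u^2\,d\omega$ for all balls $B$ and $u\in N^{1,2}_{\mathrm{loc}}(X)$. *)

(* Defs.v *)
From HB Require Import structures.
From mathcomp Require Import all_boot all_order all_algebra.
From mathcomp Require Import all_classical all_reals all_analysis measurable_realfun.

Set Implicit Arguments.
Unset Strict Implicit.
Unset Printing Implicit Defensive.

Import Order.TTheory GRing.Theory Num.Theory.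
Import numFieldNormedType.Exports.

Local Open Scope classical_set_scope.
Local Open Scope ring_scope.

(* A point is required because the library's Caratheodory sigma-algebra is
   only available on pointed types. *)
#[short(type="pointedMetricType")]
HB.structure Definition PointedMetric (K : numDomainType) :=
  {M of Metric K M & isPointed M}.

#[short(type="completeMetricType")]
HB.structure Definition CompleteMetric (K : numDomainType) :=
  {M of PointedMetric K M & Complete M}.

Section MetricSpace.
Context {R : realType} {X : pointedMetricType R}.
Local Open Scope ereal_scope.

Definition unbounded_space : Prop :=
  forall M : R, exists x y : X, (M < mdist x y)%R.

Definition borel_set (A : set X) : Prop := <<s (@open X) >> A.

Definition borel_fun (g : X -> \bar R) : Prop :=
  measurable_fun setT (g : g_sigma_algebraType (@open X) -> \bar R).

Definition curve_length (a b : R) (f : R -> X) : \bar R :=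
  ereal_sup [set (\sum_(0 <= i < size s)
      mdist (f (nth b (a :: s) i)) (f (nth b (a :: s) i.+1)))%:E
    | s in itv_partition a b].

End MetricSpace.

Arguments unbounded_space {R} X.

(* Nonconstant rectifiable curves, parametrised by arc length: path integrals,
   upper gradients and the modulus do not depend on the parametrisation, and
   every nonconstant rectifiable curve is a reparametrisation of such a curve.
   The values of curve_fun outside `[0, curve_len] are irrelevant. *)
Record curve (R : realType) (X : pointedMetricType R) := Curve {
  curve_len : R;
  curve_fun :> R -> X;
  curve_len_gt0 : 0 < curve_len;
  curve_arc_length : forall s t, 0 <= s -> s <= t -> t <= curve_len ->
    curve_length s t curve_fun = (t - s)%:E }.

Section NewtonianSpaces.
Context {R : realType} {X : pointedMetricType R}.
Variable omega : {outer_measure set X -> \bar R}.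
Local Open Scope ereal_scope.

(* Measures on metric spaces are outer measures defined on all subsets; one
   integrates with respect to their restriction to the
   Caratheodory-measurable sets. *)
Definition cara : {measure set (caratheodory_type omega) -> \bar R} :=
  (omega : set (caratheodory_type omega) -> \bar R).

Definition borel_regular : Prop :=
  (forall A, borel_set A -> omega.-caratheodory A) /\
  (forall A : set X, exists B, [/\ borel_set B, A `<=` B & omega B = omega A]).

Definition full_support : Prop :=
  forall (x : X) (r : R), (0 < r)%R -> 0 < omega (ball x r).

Definition doubling : Prop :=
  exists C_D : R, forall (x : X) (r : R), (0 < r)%R ->
    [/\ 0 < omega (ball x (2 * r)),
        omega (ball x (2 * r)) <= C_D%:E * omega (ball x r)
      & C_D%:E * omega (ball x r) < +oo].

Definition average (u : X -> R) (B : set X) : R :=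
  (fine (omega B))^-1 * Rintegral cara B u.

Definition path_integral (g : X -> \bar R) (c : curve X) : \bar R :=
  \int[lebesgue_measure]_(t in `[0%R, curve_len c]) g (c t).

Definition modulus (Gamma : set (curve X)) : \bar R :=
  ereal_inf [set \int[cara]_x (rho x ^+ 2) | rho in
    [set rho : X -> \bar R | [/\ borel_fun rho, forall x, 0 <= rho x
      & forall c, Gamma c -> 1 <= path_integral rho c]]].

(* Weak upper gradients in the open set U: only the curves inside U are tested,
   and the exceptional ones among them have zero 2-modulus. *)
Definition weak_upper_gradient (U : set X) (u : X -> R) (g : X -> \bar R) :
    Prop :=
  [/\ borel_fun g, forall x, 0 <= g x
    & modulus [set c : curve X |
        (forall t, 0 <= t <= curve_len c -> U (c t))%R /\
        ~ `|u (c (curve_len c)) - u (c 0%R)|%:E <= path_integral g c] = 0].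

Definition L2loc (g : X -> \bar R) : Prop :=
  forall x, exists2 r : R, (0 < r)%R & \int[cara]_(y in ball x r) (g y ^+ 2) < +oo.

Definition minimal_weak_upper_gradient (u : X -> R) (g : X -> \bar R) : Prop :=
  [/\ weak_upper_gradient setT u g, L2loc g
    & forall g', weak_upper_gradient setT u g' -> L2loc g' ->
        {ae cara, forall x, g x <= g' x}].

Definition measurable_on (U : set X) (u : X -> R) : Prop :=
  measurable_fun (U : set (caratheodory_type omega)) (u : _ -> R).

Definition locally_integrable_on_space (u : X -> R) : Prop :=
  measurable_on setT u /\
  forall x, exists2 r : R, (0 < r)%R & \int[cara]_(y in ball x r) `|u y|%:E < +oo.

Definition N12 (U : set X) (u : X -> R) : Prop :=
  [/\ measurable_on U u, \int[cara]_(x in U) (u x ^+ 2)%:E < +oo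
    & exists2 g, weak_upper_gradient U u g
                 & \int[cara]_(x in U) (g x ^+ 2) < +oo].

Definition N12loc (u : X -> R) : Prop :=
  forall x, exists2 r : R, (0 < r)%R & N12 (ball x r) u.

Definition N12zero (Omega : set X) (u : X -> R) : Prop :=
  N12 setT u /\ forall x, ~ Omega x -> u x = 0%R.

Definition poincare : Prop :=
  exists C_P lambda_P : R, [/\ (0 < C_P)%R, (1 <= lambda_P)%R
    & forall (x : X) (r : R) (u : X -> R) (g : X -> \bar R), (0 < r)%R ->
        locally_integrable_on_space u -> weak_upper_gradient setT u g ->
        let B := ball x r in
        let lB := ball x (lambda_P * r) in
        ((fine (omega B))^-1)%:E *
          \int[cara]_(y in B) `|u y - average u B|%:E
        <= (C_P * r)%:E *
          (((fine (omega lB))^-1)%:E * \int[cara]_(y in lB) (g y ^+ 2))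
            `^ (2^-1)].

Definition PI_space : Prop :=
  [/\ borel_regular, full_support, doubling & poincare].

Definition sobolev_poincare (lambda2 : R) : Prop :=
  (1 <= lambda2)%R /\
  exists2 C : R, (0 < C)%R
    & forall (x : X) (r : R) (u : X -> R) (g : X -> \bar R), (0 < r)%R ->
        N12loc u -> minimal_weak_upper_gradient u g ->
        let B := ball x r in
        \int[cara]_(y in B) ((u y - average u B) ^+ 2)%:E
        <= (C * r ^+ 2)%:E *
             \int[cara]_(y in ball x (lambda2 * r)) (g y ^+ 2).

(* The Sobolev 2-capacity, whose null sets are the exceptional sets in
   "quasieverywhere". *)
Definition sobolev_capacity (E : set X) : \bar R :=
  ereal_inf [set z | exists (u : X -> R) (g : X -> \bar R),
    [/\ N12 setT u, weak_upper_gradient setT u g,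
        forall x, E x -> (1 <= u x)%R
      & z = \int[cara]_x (u x ^+ 2)%:E + \int[cara]_x (g x ^+ 2)]].

Definition quasieverywhere_on (K : set X) (P : X -> Prop) : Prop :=
  sobolev_capacity [set x | K x /\ ~ P x] = 0.

Definition quasicontinuous (u : X -> R) : Prop :=
  forall e : R, (0 < e)%R ->
    exists G : set X, [/\ open G, sobolev_capacity G < e%:E
                        & {within ~` G, continuous u}].

Definition quasicontinuous_representative (v w : X -> R) : Prop :=
  quasicontinuous w /\ {ae cara, forall x, w x = v x}.

Definition capacity (K Omega : set X) : \bar R :=
  ereal_inf [set z | exists (v w : X -> R) (g : X -> \bar R),
    [/\ N12zero Omega v, quasicontinuous_representative v w,
        quasieverywhere_on K (fun x => (1 <= w x)%R),
        minimal_weak_upper_gradient v g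
      & z = \int[cara]_(x in Omega) (g x ^+ 2)]].

(* The content of K relative to the ball of centre x0 and radius rho; the
   countable (possibly finite) families are indexed by D. *)
Definition codim_content (K : set X) (x0 : X) (rho : R) : \bar R :=
  ereal_inf [set z | exists (D : set nat) (c : nat -> X) (r : nat -> R),
    [/\ forall i, D i -> ball x0 rho (c i) /\ (0 < r i <= rho)%R,
        K `<=` \bigcup_(i in D) ball (c i) (r i)
      & z = \esum_(i in D) (omega (ball (c i) (r i)) * ((r i ^+ 2)^-1)%:E)]].

End NewtonianSpaces.

(* Main.v *)
Require Import Defs.
From HB Require Import structures.
From mathcomp Require Import all_boot all_order all_algebra.
From mathcomp Require Import all_classical all_reals all_analysis measurable_realfun.
From mathcomp Require Import ring lra.
Set Implicit Arguments.
Unset Strict Implicit.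
Unset Printing Implicit Defensive.
Import Order.TTheory GRing.Theory Num.Theory.
Import numFieldNormedType.Exports.
Local Open Scope classical_set_scope.
Local Open Scope ring_scope.

(* The space is the half-line [0, +oo[ with the measure t dt, that is, the
   radial part of the plane, and K is the endpoint {0}, with B_0 = B(0, 1).

   A ball B(c, r) has measure at least (c + r) r / 4 >= r^2 / 4, so covering
   even one point costs at least 1/4.

   The function rho(t) = 1 / (t (1 - ln t)) on ]0, 1] has finite norm in
   L^2(t dt) but is not integrable at 0, and it is nonincreasing.  A curve
   c parametrised by arc length and starting at 0 satisfies c(t) <= t, hence
   its rho-length is infinite.  Therefore e * rho is an upper gradient of the
   indicator function of {0} for every e > 0, {0} has zero Sobolev capacity,
   and the zero function is admissible for the condenser capacity.

   For the Poincare inequalities, a single segment [a, b] with a > 0 has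
   positive modulus, so |u(b) - u(a)|^2 <= (b - a) / a * \int_a^b g^2 t dt by
   Cauchy-Schwarz.  If k is the midpoint of the interval B, of length l, this
   gives |u(t) - u(k)|^2 <= (l / t) \int_B g^2 for t in B, which one integrates
   against t dt; the dilation constants are 1. *)

(** * Measures given by a density *)

Section density_measure.
Local Open Scope ereal_scope.
Context d (T : measurableType d) (R : realType).
Variables (mu : {measure set T -> \bar R}) (w : T -> R).

(** The proofs of nonnegativity and measurability are arguments of the definition, so that a measure
    structure can be attached to every term of this shape. *)
Definition density_measure of (forall x, (0 <= w x)%R) & measurable_fun setT w :
  set T -> \bar R := fun A => \int[mu]_(x in A) (w x)%:E.

Hypotheses (w0 : forall x, (0 <= w x)%R) (mw : measurable_fun setT w).
Local Notation nu := (density_measure w0 mw).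

Let nu0 : nu set0 = 0. Proof. exact: integral_set0. Qed.

Let nu_ge0 A : 0 <= nu A.
Proof. by apply: integral_ge0 => x _; rewrite lee_fin. Qed.

Let mEw D : measurable_fun D (EFin \o w).
Proof. by apply/measurable_EFinP; exact: measurable_funTS. Qed.

Let nu_sigma_additive : semi_sigma_additive nu.
Proof.
move=> F mF tF mUF; rewrite /density_measure ge0_integral_bigcup//; last first.
  by move=> x _; rewrite lee_fin.
apply: is_cvg_nneseries => n _ _.
by apply: integral_ge0 => x _; rewrite lee_fin.
Qed.

HB.instance Definition _ := isMeasure.Build _ _ _ nu nu0 nu_ge0
  nu_sigma_additive.

Import HBNNSimple.

Let ge0_integral_density_nnsfun (f : {nnsfun T >-> R}) :
  \int[nu]_x (f x)%:E = \int[mu]_x ((f x)%:E * (w x)%:E).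
Proof.
rewrite integralT_nnsfun sintegralE.
under [RHS]eq_integral => x _ do
  (rewrite fimfunE -fsumEFin// muleC ge0_mule_fsumr;
   last by move=> r; rewrite EFinM nnfun_muleindic_ge0).
rewrite ge0_integral_fsum//; last 2 first.
- move=> r; apply/measurable_EFinP; apply: measurable_funM => //.
  exact: measurableT_comp.
- move=> r x _; rewrite mule_ge0//; first by rewrite lee_fin.
  by rewrite EFinM nnfun_muleindic_ge0.
apply: eq_fsbigr => r /[!inE] -[x0 _ fx0].
have r0 : (0 <= r)%R by rewrite -fx0.
rewrite /= /density_measure integral_mkcond -ge0_integralZl//; last 2 first.
- apply/(measurable_restrictT _ _).1 => //.
- by move=> x _; apply: erestrict_ge0 => y _; rewrite lee_fin.
apply: eq_integral => x _; rewrite patchE indicE.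
by case: (x \in _); rewrite ?mulr1 ?mulr0 ?mule0// muleC.
Qed.

Let ge0_integral_densityT (h : T -> \bar R) :
  measurable_fun setT h -> (forall x, 0 <= h x) ->
  \int[nu]_x h x = \int[mu]_x (h x * (w x)%:E).
Proof.
move=> mh h0; pose h_ := nnsfun_approx measurableT mh.
have h_cvg x : (h_ n x)%:E @[n --> \oo] --> h x by exact: cvg_nnsfun_approx.
have h_nd x : {homo (fun n => (h_ n x)%:E) : n m / (n <= m)%N >-> n <= m}.
  by move=> n m nm; rewrite lee_fin; exact/lefP/nd_nnsfun_approx.
transitivity (lim (\int[nu]_x (h_ n x)%:E @[n --> \oo])).
  rewrite -monotone_convergence//=.
  - by apply: eq_integral => x _; apply/esym/cvg_lim.
  - by move=> n; exact/measurable_EFinP/measurable_funTS.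
  - by move=> n x _; rewrite lee_fin.
transitivity (lim (\int[mu]_x ((h_ n x)%:E * (w x)%:E) @[n --> \oo])).
  by apply: congr_lim; apply/funext => n; exact: ge0_integral_density_nnsfun.
rewrite -monotone_convergence//=.
- by apply: eq_integral => x _; apply/cvg_lim => //; exact: cvgeZr.
- by move=> n; apply: emeasurable_funM => //; exact/measurable_EFinP.
- by move=> n x _; rewrite mule_ge0// lee_fin.
- by move=> x _ n m nm; rewrite lee_wpmul2r ?h_nd// lee_fin.
Qed.

(** Holds for simple functions by splitting along their values, then for nonnegative functions by
    monotone convergence; the domain [D] is reached through extension by zero. *)
Lemma ge0_integral_density (D : set T) (h : T -> \bar R) :
  measurable D -> measurable_fun D h -> (forall x, D x -> 0 <= h x) ->
  \int[nu]_(x in D) h x = \int[mu]_(x in D) (h x * (w x)%:E).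
Proof.
move=> mD mh h0.
rewrite [LHS]integral_mkcond ge0_integral_densityT; last 2 first.
- exact/(measurable_restrictT _ _).1.
- by move=> x; exact: erestrict_ge0.
rewrite [RHS]integral_mkcond; apply: eq_integral => x _.
by rewrite !patchE; case: ifP => // _; rewrite mul0e.
Qed.

End density_measure.

(** * Cauchy-Schwarz against the constant 1 *)

Section cauchy_schwarz.
Local Open Scope ereal_scope.
Context d (T : measurableType d) (R : realType).
Variable mu : {measure set T -> \bar R}.

(** Obtained by integrating the pointwise inequality f <= t / 2 + f^2 / (2 t) and then choosing t.
    An infinite right-hand side is treated first. *)
Lemma integral_cauchy_schwarz (D : set T) (m : R) (f : T -> \bar R) :
  measurable D -> (0 < m)%R -> mu D = m%:E -> measurable_fun D f ->
  (forall x, D x -> 0 <= f x) ->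
  (\int[mu]_(x in D) f x) ^+ 2 <= m%:E * \int[mu]_(x in D) (f x ^+ 2).
Proof.
move=> mD m0 muD mf f0.
have mf2 : measurable_fun D (fun x => f x ^+ 2).
  exact: (emeasurable_funM mf mf).
have f20 x : D x -> 0 <= f x ^+ 2 by move=> _; exact: sqre_ge0.
have I20 : 0 <= \int[mu]_(x in D) (f x ^+ 2) by exact: integral_ge0.
have [->|I2y] := eqVneq (\int[mu]_(x in D) (f x ^+ 2)) +oo.
  by rewrite gt0_muley ?leey// lte_fin.
have I2fin : \int[mu]_(x in D) (f x ^+ 2) \is a fin_num.
  by rewrite ge0_fin_numE// lt_neqAle I2y leey.
have amgm (t : R) : (0 < t)%R ->
    \int[mu]_(x in D) f x <=
    (t / 2)%:E * m%:E + ((2 * t)^-1)%:E * \int[mu]_(x in D) (f x ^+ 2).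
  move=> t0; rewrite -muD -integral_cst// -ge0_integralZl//; last first.
    by rewrite lee_fin invr_ge0 mulr_ge0// ltW.
  rewrite -ge0_integralD//=; first last.
  - by apply: measurable_funeM.
  - by move=> x Dx; rewrite mule_ge0 ?f20// lee_fin invr_ge0 mulr_ge0// ltW.
  - by move=> x _; rewrite lee_fin divr_ge0// ltW.
  apply: ge0_le_integral => //= [|x Dx].
    apply: emeasurable_funD => //; exact: measurable_funeM.
  move: (f0 x Dx); case: (f x) => [r| |] //= r0.
    rewrite -!EFinM -EFinD lee_fin -expr2.
    have -> : (t / 2 + (2 * t)^-1 * r ^+ 2 = r + (2 * t)^-1 * (r - t) ^+ 2)%R.
      by field; rewrite gt_eqF.
    by rewrite lerDl mulr_ge0 ?sqr_ge0// invr_ge0 mulr_ge0// ltW.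
  rewrite mulyy gt0_muley ?addey// lte_fin invr_gt0.
  by rewrite mulr_gt0.
have I0 : 0 <= \int[mu]_(x in D) f x by exact: integral_ge0.
have Ifin : \int[mu]_(x in D) f x \is a fin_num.
  (* Any positive t gives finiteness of the integral; t = 1 is taken. *)
  rewrite ge0_fin_numE//; apply: le_lt_trans (amgm 1%R ltr01) _.
  by rewrite -(fineK I2fin) -!EFinM -EFinD ltry.
move: I20 I0 amgm; rewrite -(fineK I2fin) -(fineK Ifin).
move: (fine _) (fine _) => I S; rewrite !lee_fin => S0 I0 amgm.
rewrite -expr2.
move: I0; rewrite le_eqVlt => /predU1P[<-|I0].
  by rewrite expr0n/= mulr_ge0// ltW.
(* With t = I / m the inequality I <= t m / 2 + S / (2 t) becomes I^2 <= m S, without a square root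
   of S. *)
have /amgm : (0 < I / m)%R by rewrite divr_gt0.
rewrite -!EFinM -EFinD lee_fin => le.
have := ler_wpM2l (ltW (mulr_gt0 I0 (@ltr0Sn R 1))) le.
rewrite [leRHS](_ : _ = I ^+ 2 + m * S)%R; last first.
  by field; rewrite !gt_eqF.
lra.
Qed.

End cauchy_schwarz.

(** * Replacing a constant by the average *)

Section average.
Local Open Scope ereal_scope.
Context d (T : measurableType d) (R : realType).
Variable mu : {measure set T -> \bar R}.

(** If e is the average minus k, then (u - average)^2 <= 2 (u - k)^2 + 2 e^2, and Cauchy-Schwarz
    gives e^2 m <= s; hence the factor 4. This allows oscillation to be estimated from any
    convenient k. *)
Lemma integral_sqr_sub_average (B : set T) (m k s : R) (u : T -> R) :
  measurable B -> (0 < m)%R -> mu B = m%:E -> measurable_fun B u ->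
  \int[mu]_(x in B) ((u x - k) ^+ 2)%:E <= s%:E ->
  \int[mu]_(x in B) ((u x - m^-1 * Rintegral mu B u) ^+ 2)%:E <= (4 * s)%:E.
Proof.
move=> mB m0 muB mu_ us.
have muk : measurable_fun B (fun x => u x - k)%R by exact: measurable_funB.
have mabs : measurable_fun B (fun x => `|u x - k|%:E).
  by apply/measurable_EFinP; exact: measurableT_comp.
have cs : (\int[mu]_(x in B) `|u x - k|%:E) ^+ 2 <= (m * s)%:E.
  apply: le_trans (integral_cauchy_schwarz mB m0 muB mabs _) _ => //=.
  rewrite EFinM; apply: lee_wpmul2l; first by rewrite lee_fin ltW.
  rewrite (eq_integral (fun x => ((u x - k) ^+ 2)%:E))// => x _.
  by rewrite -EFinM -expr2 real_normK// num_real.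
have I0 : 0 <= \int[mu]_(x in B) `|u x - k|%:E by exact: integral_ge0.
have Ifin : \int[mu]_(x in B) `|u x - k|%:E \is a fin_num.
  rewrite ge0_fin_numE// ltNge leye_eq; apply/negP => /eqP Iy.
  by move: cs; rewrite Iy expe2 mulyy leNgt ltry.
have intuk : mu.-integrable B (EFin \o (fun x => u x - k)%R).
  apply/integrableP; split; first exact/measurable_EFinP.
  by rewrite -ge0_fin_numE//; exact: integral_ge0.
have intk : mu.-integrable B (EFin \o (fun=> k)).
  apply/integrableP; split; first exact: measurable_cst.
  by rewrite /= integral_cst//= muB -EFinM ltry.
pose e := (m^-1 * Rintegral mu B u - k)%R.
have em : (e * m = Rintegral mu B (fun x => u x - k))%R.
  rewrite /e.
  have -> : Rintegral mu B u = Rintegral mu B (fun x => (u x - k) + k)%R.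
    by apply: eq_Rintegral => x _; rewrite subrK.
  rewrite RintegralD// Rintegral_cst// muB /=; field.
  by rewrite gt_eqF.
have e2m : (e ^+ 2 * m <= s)%R.
  have : (`|e * m| <= fine (\int[mu]_(x in B) `|u x - k|%:E))%R.
    by rewrite em; exact: le_normr_Rintegral.
  have -> : (e ^+ 2 * m = m^-1 * `|e * m| ^+ 2)%R.
    by rewrite real_normK ?num_real//; field; rewrite gt_eqF.
  move: cs I0; rewrite -(fineK Ifin) -EFin_expe !lee_fin => cs I0 le.
  rewrite ler_pdivrMl//; apply: le_trans cs.
  by rewrite lerXn2r// nnegrE.
apply: (@le_trans _ _ (\int[mu]_(x in B)
    (2%:E * ((u x - k) ^+ 2)%:E + (2 * e ^+ 2)%:E))).
  apply: ge0_le_integral => //=.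
  - by move=> x _; rewrite lee_fin sqr_ge0.
  - apply/measurable_EFinP; apply: measurable_funX; exact: measurable_funB.
  - apply/measurable_EFinP; apply: measurable_funD => //.
    by apply: measurable_funM => //; exact: measurable_funX.
  - move=> x _; rewrite -EFinM -EFinD lee_fin -subr_ge0 /e.
    set c := (m^-1 * _)%R.
    have -> : (2 * (u x - k) ^+ 2 + 2 * (c - k) ^+ 2 - (u x - c) ^+ 2 =
      (u x - k + (c - k)) ^+ 2)%R by ring.
    exact: sqr_ge0.
rewrite ge0_integralD//=; first last.
- by move=> x _; rewrite lee_fin mulr_ge0// sqr_ge0.
- apply/measurable_EFinP; apply: measurable_funM => //; exact: measurable_funX.
- by move=> x _; rewrite -EFinM lee_fin mulr_ge0// sqr_ge0.
rewrite integral_cst// ge0_integralZl//=; last 2 first.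
- by apply/measurable_EFinP; exact: measurable_funX.
- by move=> x _; rewrite lee_fin sqr_ge0.
rewrite muB -EFinM (_ : (4 * s = 2 * s + 2 * s)%R); last by ring.
rewrite [leRHS]EFinD; apply: leeD; last by rewrite lee_fin -mulrA ler_pM2l.
by rewrite [leRHS]EFinM; apply: lee_wpmul2l.
Qed.

End average.

(** * The half-line as a complete metric space *)

Record halfline (R : realType) := Halfline {
  coord : R;
  coord_ge0 : 0 <= coord }.

HB.instance Definition _ (R : realType) := [isSub for @coord R].
HB.instance Definition _ (R : realType) := [Choice of halfline R by <:].

Section halfline_metric.
Context {R : realType}.
Local Notation X := (halfline R).

Lemma clamp_subproof (x : R) : 0 <= Num.max 0 x.
Proof. by rewrite le_max lexx. Qed.

(** The retraction of the line onto the half-line: functions on the half-line become functions of a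
    real variable by composition with it. *)
Definition clamp (x : R) : X := Halfline (clamp_subproof x).

Lemma clampK (x : R) : 0 <= x -> coord (clamp x) = x.
Proof. by move=> x0; rewrite /= /Num.max; case: ltgtP x0. Qed.

Lemma coordK : cancel (@coord R) clamp.
Proof. by move=> x; apply/val_inj; exact: clampK (coord_ge0 x). Qed.

Let dist (x y : X) : R := `|coord x - coord y|.

Let dist0 x : dist x x = 0.
Proof. by rewrite /dist subrr normr0. Qed.

Let dist_positivity x y : dist x y = 0 -> x = y.
Proof. by move=> /normr0_eq0/eqP; rewrite subr_eq0 => /eqP/val_inj. Qed.

Let dist_sym x y : dist x y = dist y x.
Proof. exact: distrC. Qed.

Let dist_triangle y x z : dist x z <= dist x y + dist y z.
Proof. exact: ler_distD. Qed.

HB.instance Definition _ := @isMetric.Build R (halfline R) dist dist0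
  dist_positivity dist_sym dist_triangle.
HB.instance Definition _ := isPointed.Build (halfline R) (clamp 0).

Lemma mdist_halfline (x y : X) : mdist x y = `|coord x - coord y|.
Proof. by []. Qed.

Lemma ball_halfline (x : X) (r : R) :
  ball x r = [set y | `|coord x - coord y| < r].
Proof. by rewrite ballEmdist. Qed.

Lemma continuous_coord : continuous (@coord R).
Proof.
move=> x A /nbhs_ballP[e /= e0 eA]; apply/nbhs_ballP; exists e => //= y.
by rewrite ball_halfline => xy; exact: eA.
Qed.

Lemma mdist_clamp (x y : R) : mdist (clamp x) (clamp y) <= `|x - y|.
Proof.
have h1 := ler_norm (x - y); have h2 := ler_norm (- (x - y)).
rewrite normrN in h2; rewrite mdist_halfline /= ler_norml /Num.max.
by case: ltP => x0; case: ltP => y0; apply/andP; split; lra.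
Qed.

Lemma continuous_clamp : continuous clamp.
Proof.
move=> x A /nbhs_ballP[e /= e0 eA]; apply/nbhs_ballP; exists e => //= y xy.
by apply: eA; rewrite ballEmdist; exact: le_lt_trans (mdist_clamp x y) xy.
Qed.

(** The coordinate is an isometry, so the image filter is Cauchy in the line; its limit is brought
    back by the continuous map [clamp], a left inverse of [coord]. *)
Let complete (F : set_system X) :
  ProperFilter F -> cauchy F -> cvg F.
Proof.
move=> PF /cauchy_ballP cF.
have cvF : cauchy ((@coord R : X -> R^o) @ F).
  apply/cauchy_ballP => e e0; have := cF e e0.
  rewrite !near_simpl => -[[A B] /= [FA FB] AB].
  exists ((@coord R : X -> R^o) @` A, (@coord R : X -> R^o) @` B) => /=.
    by split; [apply: filterS FA|apply: filterS FB] => z Az; exists z.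
  by move=> -[_ _] [[/= z Az <-] [w Bw <-]]; exact: (AB (z, w)).
have vl : (@coord R : X -> R^o) @ F --> lim ((@coord R : X -> R^o) @ F).
  exact: cauchy_cvg.
apply: (cvgP (clamp (lim ((@coord R : X -> R^o) @ F)))).
have := cvg_comp _ _ vl (@continuous_clamp _).
by rewrite (_ : _ \o _ = id)//; apply/funext => z /=; exact: coordK.
Qed.

HB.instance Definition _ := @Uniform_isComplete.Build (halfline R) complete.

End halfline_metric.

(** * The weighted measure, its Borel regularity and its integrals *)

Section halfline_measure.
Local Open Scope ereal_scope.
Context {R : realType}.
Local Notation X := (halfline R).
Local Notation XB := (g_sigma_algebraType (@open X)).
Local Notation lambda := (@lebesgue_measure R).

Lemma open_measurable_halfline (A : set X) :
  open A -> measurable (A : set XB).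
Proof. exact: sub_sigma_algebra. Qed.

Lemma measurable_clamp :
  measurable_fun setT (clamp : measurableTypeR R -> XB).
Proof.
apply: (@measurability _ _ _ XB setT clamp (@open X)) => // _ [A oA <-].
rewrite setTI; apply: open_measurable.
by apply: open_comp => // x _; exact: continuous_clamp.
Qed.

Lemma measurable_coord : measurable_fun setT (@coord R : XB -> R).
Proof.
apply: (measurability (RGenOpens.G (R := R)) (RGenOpens.measurableE R)).
move=> _ [_ [a [b ->]] <-]; rewrite setTI.
apply: open_measurable_halfline; apply: open_comp.
  by move=> x _; exact: continuous_coord.
exact: interval_open.
Qed.

Definition weight (x : R) : R := Num.max 0%R x.

Lemma weight_ge0 x : (0 <= weight x)%R.
Proof. by rewrite le_max lexx. Qed.

Lemma measurable_weight : measurable_fun setT weight.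
Proof. exact: measurable_maxr. Qed.

(* [clamp] sends ]-oo, 0] to the endpoint, which the weight makes negligible. *)
Definition halfline_premeasure : {measure set XB -> \bar R} :=
  measure_function_pushforward__canonical__measure_function_Measure
    (density_measure lambda weight_ge0 measurable_weight) measurable_clamp.

Definition halfline_measure : {outer_measure set X -> \bar R} :=
  [the {outer_measure set XB -> \bar R} of mu_ext halfline_premeasure].

Local Notation omega := halfline_measure.

Lemma halfline_measureE (A : set X) : borel_set A ->
  omega A = \int[lambda]_(x in clamp @^-1` A) (weight x)%:E.
Proof.
move=> bA; exact: (@measurable_mu_extE _ _ _ halfline_premeasure).
Qed.

Lemma borel_caratheodory (A : set X) : borel_set A -> omega.-caratheodory A.
Proof. exact: (@caratheodory_measurable_mu_ext _ _ XB halfline_premeasure). Qed.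

(** A Borel hull of a set of finite measure is the intersection of Borel supersets whose measures
    exceed its own by at most 1 / (n + 1); each is the union of a nearly optimal countable cover. A
    set of infinite measure has the whole space as hull. *)
Lemma borel_regular_halfline : borel_regular omega.
Proof.
split; first exact: borel_caratheodory.
move=> A; have [Aoo|] := eqVneq (omega A) +oo.
  exists setT; split => //; first exact: (@measurableT _ XB).
  by apply/eqP; rewrite eq_le; apply/andP; split; rewrite ?Aoo ?leey// -Aoo;
    apply: le_outer_measure.
move=> Aoo; have Afin : omega A \is a fin_num.
  by rewrite ge0_fin_numE ?outer_measure_ge0// ltey.
have cover (n : nat) : exists B : set X,
    [/\ borel_set B, A `<=` B & omega B <= omega A + (n.+1%:R^-1)%:E].
  have n0 : (0 < n.+1%:R^-1 :> R)%R by [].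
  have [_ [F [mF AF] <-] Flt] := lb_ereal_inf_adherent n0 Afin.
  exists (\bigcup_k F k); split => //; first exact: (@bigcup_measurable _ XB).
  apply: le_trans (ltW Flt).
  apply: le_trans (outer_measure_sigma_subadditive _ _) _.
  apply: lee_nneseries => [k _ _|k _]; first exact: outer_measure_ge0.
  by rewrite [leLHS](@measurable_mu_extE _ _ _ halfline_premeasure)//.
have [B /all_and3[bB AB Ble]] := choice cover.
exists (\bigcap_k B k); split.
- by apply: (@bigcap_measurableType _ XB) => k _; exact: bB.
- by move=> x Ax k _; exact: AB.
- apply/eqP; rewrite eq_le; apply/andP; split; last first.
    by apply: le_outer_measure => x Ax k _; exact: AB.
  apply/lee_addgt0Pr => e e0.
  have [n ne] : exists n : nat, (n.+1%:R^-1 <= e)%R.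
    exists (Num.truncn e^-1); rewrite -[leRHS]invrK lef_pV2 ?posrE ?invr_gt0//.
    by rewrite ltW// truncnS_gt.
  apply: le_trans (le_trans (Ble n) _); last by rewrite leeD2l// lee_fin.
  by apply: le_outer_measure => x; exact.
Qed.

(** Composing with this identity, or pushing a measure forward along it, passes between the Borel
    and the Caratheodory sigma-algebras. *)
Lemma measurable_borel_cara :
  measurable_fun setT (id : caratheodory_type omega -> XB).
Proof. by move=> _ B bB; rewrite setTI; exact: borel_caratheodory. Qed.

Lemma borel_set_measurable_cara (D : set X) : borel_set D ->
  measurable (D : set (caratheodory_type omega)).
Proof. exact: borel_caratheodory. Qed.

Lemma borel_fun_measurable_cara (D : set X) (h : X -> \bar R) : borel_fun h ->
  measurable_fun (D : set (caratheodory_type omega)) (h : _ -> \bar R).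
Proof.
move=> bh; apply: measurable_funTS.
exact: (measurableT_comp bh measurable_borel_cara).
Qed.

Lemma borel_fun_measurable_clamp (D : set R) (h : X -> \bar R) :
  borel_fun h -> measurable_fun D (h \o clamp).
Proof.
move=> bh; apply: measurable_funTS.
exact: (measurableT_comp bh measurable_clamp).
Qed.

(** Two image measures are involved: along the identity the Caratheodory measure becomes the Borel
    premeasure, which is itself the image under [clamp] of the measure with density [weight]. *)
Lemma integral_cara_halfline (D : set X) (h : X -> \bar R) :
  borel_set D -> borel_fun h -> (forall x, 0 <= h x) ->
  \int[cara omega]_(x in D) h x =
  \int[lambda]_(x in clamp @^-1` D) (h (clamp x) * (weight x)%:E).
Proof.
move=> bD bh h0.
have mD : measurable (clamp @^-1` D).
  by rewrite -[X in measurable X]setTI; exact: measurable_clamp.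
have bhD : measurable_fun (D : set XB) (h : XB -> \bar R).
  exact: measurable_funTS.
transitivity (\int[pushforward (cara omega) (id : _ -> XB)]_(x in D) h x).
  rewrite (ge0_integral_pushforward measurable_borel_cara)//.
transitivity (\int[halfline_premeasure]_(x in D) h x).
  apply: eq_measure_integral => [|mid A mA _].
    exact: measurable_borel_cara.
  exact: (@measurable_mu_extE _ _ _ halfline_premeasure).
rewrite [LHS](ge0_integral_pushforward measurable_clamp
  (density_measure lambda weight_ge0 measurable_weight))//.
rewrite ge0_integral_density//.
  exact: borel_fun_measurable_clamp.
by move=> x _; exact: h0.
Qed.

End halfline_measure.

(** * Balls as intervals, full support and doubling *)

Section halfline_balls.
Local Open Scope ereal_scope.
Context {R : realType}.
Local Notation X := (halfline R).
Local Notation lambda := (@lebesgue_measure R).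
Local Notation omega := (@halfline_measure R).

(** A ball reaching past 0 is cut off there, so its interval may be shorter than 2 r and have a
    midpoint different from the centre. *)
Definition ball_left (x : X) (r : R) : R := Num.max 0%R (coord x - r)%R.
Definition ball_right (x : X) (r : R) : R := (coord x + r)%R.

Lemma ball_left_ge0 x r : (0 <= ball_left x r)%R.
Proof. by rewrite le_max lexx. Qed.

Lemma ball_left_le x r : (0 < r)%R -> (ball_left x r <= coord x)%R.
Proof. by move=> r0; rewrite ge_max coord_ge0 gerBl ltW. Qed.

Lemma ball_left_lt_right x r : (0 < r)%R -> (ball_left x r < ball_right x r)%R.
Proof.
by move=> r0; apply: le_lt_trans (ball_left_le x r0) _; rewrite ltrDl.
Qed.

Lemma ball_length_le x r : (ball_right x r - ball_left x r <= 2 * r)%R.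
Proof.
have : (coord x - r <= ball_left x r)%R by rewrite le_max lexx orbT.
by rewrite /ball_right; lra.
Qed.

Lemma borel_ball (x : X) (r : R) : borel_set (ball x r).
Proof.
have -> : ball x r = @coord R @^-1` `](coord x - r)%R, (coord x + r)%R[.
  rewrite ball_halfline; apply/seteqP.
  by split => y /=; rewrite in_itv/= ltr_distlC.
apply: sub_sigma_algebra; apply: open_comp; last exact: interval_open.
by move=> y _; exact: continuous_coord.
Qed.

(** The restriction to positive t matters: if the ball contains the endpoint, [clamp t] lies in it
    for every t <= 0, while the open interval has no such t. *)
Lemma ball_clamp x r t : (0 < t)%R ->
  ball x r (clamp t) <-> t \in `]ball_left x r, ball_right x r[.
Proof.
move=> t0; rewrite ball_halfline; change (`|coord x - coord (clamp t)| < r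
  <-> t \in `]ball_left x r, ball_right x r[)%R; rewrite clampK ?ltW//.
rewrite in_itv /= gt_max t0 ltr_distl /ball_right /=.
by split => [/andP[]|/andP[]] ? ?; apply/andP; split; lra.
Qed.

Lemma weight_le0 (t : R) : (t <= 0)%R -> weight t = 0%R.
Proof. by rewrite /weight /Num.max ltNge => ->. Qed.

Lemma weight_gt0 (t : R) : (0 < t)%R -> weight t = t.
Proof. by rewrite /weight /Num.max => ->. Qed.

(** The preimage of the ball and the interval differ only at t <= 0, where the weight vanishes. *)
Lemma integral_ball x r (h : X -> \bar R) : borel_fun h ->
  (forall y, 0 <= h y) ->
  \int[cara omega]_(y in ball x r) h y =
  \int[lambda]_(t in `]ball_left x r, ball_right x r[) (h (clamp t) * t%:E).
Proof.
move=> bh h0; rewrite integral_cara_halfline//; last exact: (borel_ball x r).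
rewrite integral_mkcond [RHS]integral_mkcond; apply: eq_integral => t _.
rewrite !patchE; have [t0|t0] := leP t 0%R.
  rewrite weight_le0// mule0 if_same memNset//= in_itv/= gt_max.
  by rewrite ltNge t0.
rewrite weight_gt0//; congr (if _ then _ else _).
by apply/idP/idP; rewrite !inE => /ball_clamp; apply.
Qed.

Lemma measure_ball x r :
  omega (ball x r) =
  \int[lambda]_(t in `]ball_left x r, ball_right x r[) t%:E.
Proof.
transitivity (\int[cara omega]_(y in ball x r) (cst 1 y)).
  rewrite integral_cst ?mul1e//.
  by apply: borel_set_measurable_cara; exact: (borel_ball x r).
rewrite integral_ball//; last exact: measurable_cst.
by apply: eq_integral => t _; rewrite mul1e.
Qed.

Lemma lebesgue_measure_oo (a b : R) : (a <= b)%R ->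
  lambda `]a, b[ = (b - a)%:E.
Proof.
rewrite lebesgue_measure_itv/= lte_fin le_eqVlt => /predU1P[->|->//].
by rewrite ltxx subrr.
Qed.

Lemma measure_ball_le x r : (0 < r)%R ->
  omega (ball x r) <= (2 * r * (coord x + r))%:E.
Proof.
move=> r0; have lr := ltW (ball_left_lt_right x r0).
have r0' : (0 <= ball_right x r)%R by exact: le_trans (ball_left_ge0 x r) lr.
rewrite measure_ball.
apply: (@le_trans _ _ (\int[lambda]_(t in `]ball_left x r, ball_right x r[)
  (cst (ball_right x r)%:E t))).
  apply: ge0_le_integral => //=.
  - by move=> t; rewrite in_itv/= => /andP[lt _]; rewrite lee_fin
      (le_trans (ball_left_ge0 x r))// ltW.
  - by move=> t; rewrite in_itv/= => /andP[_ tr]; rewrite lee_fin ltW.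
rewrite integral_cst//= lebesgue_measure_oo// -EFinM lee_fin mulrC.
by rewrite ler_wpM2r// ball_length_le.
Qed.

(** Only the right half of the interval is kept: there t >= m >= (c + r) / 2, c being the coordinate
    of [x], and the length is at least r / 2. *)
Lemma measure_ball_ge x r : (0 < r)%R ->
  ((coord x + r) * r / 4)%:E <= omega (ball x r).
Proof.
move=> r0; have lr := ltW (ball_left_lt_right x r0).
have l0 := ball_left_ge0 x r; have lx := ball_left_le x r0.
pose m := ((ball_left x r + ball_right x r) / 2)%R.
have m1 : ((coord x + r) / 2 <= m)%R by rewrite /m /ball_right; lra.
have m2 : (r / 2 <= ball_right x r - m)%R by rewrite /m /ball_right; lra.
have m0 : (0 <= m)%R by rewrite /m; lra.
rewrite measure_ball.
apply: (@le_trans _ _ (\int[lambda]_(t in `]m, ball_right x r[) (cst m%:E t))).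
  rewrite integral_cst//= lebesgue_measure_oo; last by lra.
  rewrite -EFinM lee_fin.
  have -> : ((coord x + r) * r / 4 = (coord x + r) / 2 * (r / 2))%R by field.
  by rewrite ler_pM// ?divr_ge0 ?addr_ge0 ?coord_ge0 ?ltW.
apply: (@le_trans _ _ (\int[lambda]_(t in `]m, ball_right x r[) t%:E)).
  apply: ge0_le_integral => //= t; rewrite in_itv/= => /andP[mt _].
  by rewrite lee_fin ltW.
apply: ge0_subset_integral => //=.
- move=> t; rewrite in_itv/= => /andP[lt _].
  by rewrite lee_fin (le_trans l0)// ltW.
- by apply: subset_itvr; rewrite bnd_simp; rewrite /m; lra.
Qed.

Lemma full_support_halfline : full_support omega.
Proof.
move=> x r r0; apply: lt_le_trans (measure_ball_ge x r0).
by rewrite lte_fin divr_gt0// mulr_gt0// ltr_wpDl// coord_ge0.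
Qed.

Lemma doubling_halfline : doubling omega.
Proof.
(* With c the coordinate of [x], the upper bound for the double ball is 4 r (c + 2 r) <= 8 r (c +
   r), which is 32 times the lower bound (c + r) r / 4. *)
exists 32%R => x r r0; have r20 : (0 < 2 * r)%R by rewrite mulr_gt0.
split; first exact: full_support_halfline.
  apply: le_trans (measure_ball_le x r20) _.
  apply: le_trans (lee_wpmul2l _ (measure_ball_ge x r0)) => //.
  rewrite -EFinM lee_fin.
  have -> : (32 * ((coord x + r) * r / 4) =
    2 * (2 * r) * (coord x + 2 * r) + 4 * r * coord x)%R by field.
  by rewrite lerDl !mulr_ge0// ?coord_ge0 ?ltW.
rewrite lte_mul_pinfty// ?lee_fin//.
by apply: le_lt_trans (measure_ball_le x r0) _; exact: ltry.
Qed.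

End halfline_balls.

(** * Translation invariance of the Lebesgue integral *)

Section lebesgue_translation.
Local Open Scope ereal_scope.
Context {R : realType}.
Local Notation lambda := (@lebesgue_measure R).

Local Notation addl a :=
  (fun t : measurableTypeR R => (a + t)%R : measurableTypeR R).

Lemma measurable_addl (a : R) : measurable_fun setT (addl a).
Proof. exact: measurable_funD. Qed.

(** The image of Lebesgue measure under translation gives every interval ]x, y] its length, so it is
    Lebesgue measure by uniqueness. *)
Lemma ge0_integral_translation (a b c : R) (f : R -> \bar R) :
  measurable_fun setT f -> (forall t, 0 <= f t) ->
  \int[lambda]_(t in `[b, c]) f (a + t)%R =
  \int[lambda]_(t in `[(a + b)%R, (a + c)%R]) f t.
Proof.
move=> mf f0.
have -> : `[b, c]%classic = (fun t => (a + t)%R) @^-1` `[(a + b)%R, (a + c)%R].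
  by apply/seteqP; split => t /=; rewrite !in_itv/= !lerD2l.
transitivity (\int[pushforward lambda (addl a)]_(t in
    `[(a + b)%R, (a + c)%R]) f t).
  rewrite (ge0_integral_pushforward (measurable_addl a))//.
  exact: measurable_funTS.
apply: eq_measure_integral => [|mid A mA _]; first exact: measurable_addl.
rewrite -(@lebesgue_measure_unique R
  (measure_function_pushforward__canonical__measure_function_Measure
    lambda (measurable_addl a)))//.
move=> _ [[x y] /= xy <-]; rewrite /pushforward /=.
have -> : (fun t => (a + t)%R) @^-1` `]x, y] = `](x - a)%R, (y - a)%R]%classic.
  by apply/seteqP; split => t /=; rewrite !in_itv/= ltrBlDl lerBrDl.
rewrite !lebesgue_measure_itv/= !lte_fin ltrD2r -!EFinD.
by case: ifP => // _; congr (_%:E); lra.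
Qed.

End lebesgue_translation.

(** * Segments away from the endpoint have positive modulus *)

Section segments.
Local Open Scope ereal_scope.
Context {R : realType}.
Local Notation X := (halfline R).
Local Notation lambda := (@lebesgue_measure R).
Local Notation omega := (@halfline_measure R).

(** The curve is monotone in the coordinate, so the sum telescopes to t - s for every partition. *)
Lemma curve_length_translation (a s t : R) : (0 <= a)%R -> (0 <= s)%R ->
    (s <= t)%R ->
  curve_length s t (fun z : R => clamp (a + z)%R : X) = (t - s)%:E.
Proof.
move=> a0 s0 st.
have lengthE l : itv_partition s t l ->
    (\sum_(0 <= i < size l) mdist (clamp (a + nth t (s :: l) i) : X)
      (clamp (a + nth t (s :: l) i.+1)))%R = (t - s)%R.
  move=> sl.
  have <- := @nondecreasing_variation _ s t id l (fun _ _ _ _ => id) sl.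
  rewrite /variation big_nat [RHS]big_nat; apply: eq_bigr => i /andP[_ il].
  have ge0 k : (k < (size l).+1)%N -> (0 <= a + nth t (s :: l) k)%R.
    move=> kl; rewrite addr_ge0// (le_trans s0)//.
    exact: itv_partition_nth_ge sl.
  rewrite mdist_halfline !clampK ?ge0//; last exact: ltnW.
  by rewrite /= distrC opprD addrACA subrr add0r.
apply/eqP; rewrite eq_le; apply/andP; split.
  by apply: ge_ereal_sup => _ /= [l sl <-]; rewrite lengthE.
(* A degenerate interval has only the empty list as partition. *)
apply: ereal_sup_ubound => /=; exists (if s == t then [::] else [:: t]).
  case: eqVneq => [->|sneqt]; first by split => //=.
  by apply: itv_partition1; rewrite lt_neqAle sneqt.
rewrite lengthE//; case: eqVneq => [->|sneqt]; first by split => //=.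
by apply: itv_partition1; rewrite lt_neqAle sneqt.
Qed.

Definition segment (a b : R) (a0 : (0 < a)%R) (ab : (a < b)%R) : curve X.
Proof.
refine (@Curve R X (b - a)%R (fun t => clamp (a + t)%R) _ _).
- by rewrite subr_gt0.
- by move=> s t s0 st _; apply: curve_length_translation => //; exact: ltW.
Defined.

Lemma path_integral_segment (a b : R) (a0 : (0 < a)%R) (ab : (a < b)%R)
    (g : X -> \bar R) : borel_fun g -> (forall x, 0 <= g x) ->
  path_integral g (segment a0 ab) = \int[lambda]_(t in `[a, b]) g (clamp t).
Proof.
move=> bg g0; rewrite /path_integral /=.
rewrite (ge0_integral_translation a 0%R (b - a)%R (f := g \o clamp))//.
- by rewrite addr0 (addrC a) subrK.
- exact: borel_fun_measurable_clamp.
- by move=> t /=.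
Qed.

(** Cauchy-Schwarz on [a, b] for Lebesgue measure gives the factor b - a; the weight t is then
    inserted at the price of 1 / a, since t >= a. *)
Lemma path_integral_segment_sqr (a b : R) (a0 : (0 < a)%R) (ab : (a < b)%R)
    (g : X -> \bar R) (D : set X) : borel_fun g -> (forall x, 0 <= g x) ->
    borel_set D -> (forall t, (a <= t <= b)%R -> D (clamp t)) ->
  path_integral g (segment a0 ab) ^+ 2 <=
  ((b - a) / a)%:E * \int[cara omega]_(x in D) (g x ^+ 2).
Proof.
move=> bg g0 bD abD; rewrite path_integral_segment//.
have ba0 : (0 < b - a)%R by rewrite subr_gt0.
have mg : measurable_fun `[a, b] (g \o clamp).
  exact: borel_fun_measurable_clamp.
have lab : lambda `[a, b] = (b - a)%:E.
  by rewrite lebesgue_measure_itv/= lte_fin ab.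
apply: le_trans (integral_cauchy_schwarz _ ba0 lab mg _) _ => //=.
rewrite EFinM -muleA; apply: lee_wpmul2l; first by rewrite lee_fin ltW.
have bg2 : borel_fun (fun x => g x ^+ 2) by exact: (emeasurable_funM bg bg).
have g20 x : 0 <= g x ^+ 2 by exact: sqre_ge0.
rewrite integral_cara_halfline// -lee_pdivrMl ?invr_gt0// invrK.
have mg2 : measurable_fun `[a, b] (fun t => g (clamp t) ^+ 2).
  exact: (emeasurable_funM mg mg).
rewrite -ge0_integralZl//; last 2 first.
- by move=> t _; exact: g20.
- by rewrite lee_fin ltW.
have mD : measurable (clamp @^-1` D : set (measurableTypeR R)).
  by rewrite -[X in measurable X]setTI; exact: measurable_clamp.
apply: (@le_trans _ _ (\int[lambda]_(t in `[a, b])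
    (g (clamp t) ^+ 2 * (weight t)%:E))).
  apply: ge0_le_integral => //=.
  - by move=> t _; apply: mule_ge0; [rewrite lee_fin ltW|exact: g20].
  - by apply: measurable_funeM; exact: (emeasurable_funM mg mg).
  - apply: emeasurable_funM; first exact: (emeasurable_funM mg mg).
    by apply/measurable_EFinP; exact: measurable_funTS measurable_weight.
  - move=> t; rewrite in_itv/= => /andP[at_ tb].
    rewrite muleC lee_wpmul2l ?g20// lee_fin.
    by rewrite weight_gt0 ?(lt_le_trans a0).
apply: ge0_subset_integral => //=.
- apply: emeasurable_funM.
    by apply: (borel_fun_measurable_clamp (h := fun x => g x ^+ 2)).
  by apply/measurable_EFinP; exact: measurable_funTS measurable_weight.
- by move=> t _; rewrite mule_ge0 ?g20// lee_fin weight_ge0.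
Qed.

(** Every admissible density has squared norm at least a / (b - a). A family of zero modulus
    therefore contains none of these segments. *)
Lemma modulus_segment (a b : R) (a0 : (0 < a)%R) (ab : (a < b)%R)
    (Gamma : set (curve X)) :
  Gamma (segment a0 ab) -> 0 < modulus omega Gamma.
Proof.
move=> Gab; apply: (@lt_le_trans _ _ (a / (b - a))%:E).
  by rewrite lte_fin divr_gt0// subr_gt0.
apply: le_ereal_inf_tmp => _ [rho [brho rho0 /(_ _ Gab) one_le] <-].
have ba0 : (0 < b - a)%R by rewrite subr_gt0.
have := path_integral_segment_sqr a0 ab brho rho0
  (@measurableT _ (g_sigma_algebraType (@open X))) (fun _ _ => I).
move=> le; have {le} : 1 <= ((b - a) / a)%:E * \int[cara omega]_x (rho x ^+ 2).
  apply: le_trans le; rewrite expe2 -[leLHS]mule1.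
  by apply: lee_pmul.
rewrite -lee_pdivrMl ?divr_gt0//.
by rewrite mule1 invf_div.
Qed.

(** If the segment violated the upper gradient inequality, it would belong to the exceptional
    family, whose modulus would then be positive. *)
Lemma weak_upper_gradient_segment (u : X -> R) (g : X -> \bar R) (a b : R)
    (D : set X) : (0 < a)%R -> (a < b)%R ->
    borel_set D -> (forall t, (a <= t <= b)%R -> D (clamp t)) ->
  weak_upper_gradient omega setT u g ->
  ((u (clamp b) - u (clamp a)) ^+ 2)%:E <=
  ((b - a) / a)%:E * \int[cara omega]_(x in D) (g x ^+ 2).
Proof.
move=> a0 ab bD abD [bg g0 mod0].
apply: le_trans (path_integral_segment_sqr a0 ab bg g0 bD abD).
have : `|u (clamp b) - u (clamp a)|%:E <= path_integral g (segment a0 ab).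
  apply: contrapT => nle; have := @modulus_segment _ _ a0 ab.
  move: mod0; set Gamma := (X in modulus _ X) => mod0 /(_ Gamma).
  have Gab : Gamma (segment a0 ab).
    split=> //=; rewrite addr0 (addrC a) subrK => le1; exact: nle.
  by move=> /(_ Gab); rewrite mod0 ltxx.
move=> le1; rewrite -real_normK ?num_real// EFin_expe !expe2.
by apply: lee_pmul => //; rewrite lee_fin.
Qed.

End segments.

(** * The Poincare inequality *)

Section halfline_poincare.
Local Open Scope ereal_scope.
Context {R : realType}.
Local Notation X := (halfline R).
Local Notation lambda := (@lebesgue_measure R).
Local Notation omega := (@halfline_measure R).

Lemma borel_inv_coord : borel_fun (fun y : X => (coord y `^ (-1))%:E).
Proof.
apply/measurable_EFinP.
exact: (measurableT_comp (measurable_powR (-1)) measurable_coord).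
Qed.

(** The weight t cancels 1 / t, and the length of the interval remains. *)
Lemma integral_ball_inv_coord (x : X) (r : R) : (0 < r)%R ->
  \int[cara omega]_(y in ball x r) (coord y `^ (-1))%:E =
  (ball_right x r - ball_left x r)%:E.
Proof.
move=> r0; rewrite integral_ball//; last 2 first.
- exact: borel_inv_coord.
- by move=> y; rewrite lee_fin powR_ge0.
rewrite (eq_integral (fun=> 1)); last first.
  move=> t; rewrite inE/= in_itv/= => /andP[lt _].
  have t0 : (0 < t)%R by exact: le_lt_trans (ball_left_ge0 x r) lt.
  rewrite -[Num.max 0%R t]/(weight t) weight_gt0// -EFinM powR_inv1 ?ltW//.
  by rewrite mulVf// gt_eqF.
by rewrite integral_cst//= mul1e lebesgue_measure_oo// ltW// ball_left_lt_right.
Qed.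

Lemma borel_coord0 : borel_set [set y : X | coord y = 0%R].
Proof.
have -> : [set y : X | coord y = 0%R] = @coord R @^-1` [set 0%R] by [].
by rewrite -[X in borel_set X]setTI; exact: measurable_coord.
Qed.

(** The preimage of the endpoint under [clamp] is ]-oo, 0], of infinite length, but the weight is
    zero on it. *)
Lemma measure_coord0 : omega [set y : X | coord y = 0%R] = 0.
Proof.
rewrite halfline_measureE; last exact: borel_coord0.
rewrite integral_mkcond integral0_eq// => t _.
rewrite patchE; case: ifP => //; rewrite inE/= => t0.
by rewrite /weight t0.
Qed.

(** The segment between [y] and the midpoint k stays in the ball, and its factor (b - a) / a is at
    most l / [coord y], where l is the length of the interval, on whichever side of k the point [y]
    lies. *)
Lemma oscillation_le (x : X) (r G : R) (u : X -> R) (g : X -> \bar R) :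
  (0 < r)%R -> weak_upper_gradient omega setT u g ->
  \int[cara omega]_(y in ball x r) (g y ^+ 2) = G%:E ->
  forall y, ball x r y -> (0 < coord y)%R ->
  ((u y - u (clamp ((ball_left x r + ball_right x r) / 2))) ^+ 2 <=
   (ball_right x r - ball_left x r) * G * coord y `^ (-1))%R.
Proof.
move=> r0 ug GE y xy y0; set k := ((_ + _) / 2)%R.
have l0 := ball_left_ge0 x r; have lr := ball_left_lt_right x r0.
have G0 : (0 <= G)%R.
  by rewrite -lee_fin -GE; apply: integral_ge0 => z _; exact: sqre_ge0.
have := xy; rewrite -[X in ball x r X]coordK ball_clamp// in_itv/=.
move=> /andP[ly yr].
have lk : (ball_left x r < k)%R by rewrite /k; lra.
have kr : (k < ball_right x r)%R by rewrite /k; lra.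
have k0 : (0 < k)%R by lra.
have seg a b : (ball_left x r < a)%R -> (a < b)%R -> (b < ball_right x r)%R ->
    ((u (clamp b) - u (clamp a)) ^+ 2 <= (b - a) / a * G)%R.
  move=> la ab br; have a0 : (0 < a)%R by lra.
  rewrite -lee_fin [leRHS]EFinM -GE.
  apply: (weak_upper_gradient_segment a0 ab (borel_ball x r) _ ug).
  move=> t /andP[at_ tb]; rewrite ball_clamp ?in_itv/=; last by lra.
  by apply/andP; split; lra.
rewrite powR_inv1; last exact: ltW.
have main : (forall z,
   0 <= z -> z <= (ball_right x r - ball_left x r) / coord y ->
   z * G <= (ball_right x r - ball_left x r) * G * (coord y)^-1)%R.
  by move=> z z0 zle; rewrite mulrAC ler_wpM2r.
have [yk|] := ltP (coord y) k; last rewrite le_eqVlt => /predU1P[yk|ky].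
- have := seg _ _ ly yk kr; rewrite coordK -sqrrN opprB => /le_trans; apply.
  apply: main; first by rewrite divr_ge0 ?ltW// subr_gt0.
  by rewrite ler_pM2r ?invr_gt0//; lra.
- rewrite yk coordK subrr expr0n/=; rewrite !mulr_ge0// ?invr_ge0 ?ltW//.
  by rewrite subr_gt0.
- have := seg _ _ lk ky yr; rewrite coordK => /le_trans; apply.
  apply: main; first by rewrite divr_ge0 ?ltW// subr_gt0.
  rewrite ler_pdivrMr// mulrAC ler_pdivlMr//.
  (* To the right of k one has [coord y] - k <= l / 2 and [coord y] <= 2 k, because the left end is
     nonnegative. *)
  apply: (@le_trans _ _ ((ball_right x r - ball_left x r) / 2 * (2 * k)))%R.
    apply: ler_pM; [lra|lra| |]; rewrite /k; lra.
  by rewrite le_eqVlt; apply/orP; left; apply/eqP; field.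
Qed.

(** Integrating the oscillation bound gives l G times the integral of 1 / [coord y], that is l^2 G,
    and l <= 2 r. *)
Lemma poincare_center (x : X) (r G : R) (u : X -> R) (g : X -> \bar R) :
  (0 < r)%R -> measurable_on omega (ball x r) u ->
  weak_upper_gradient omega setT u g ->
  \int[cara omega]_(y in ball x r) (g y ^+ 2) = G%:E ->
  \int[cara omega]_(y in ball x r)
    ((u y - u (clamp ((ball_left x r + ball_right x r) / 2))) ^+ 2)%:E <=
  (4 * r ^+ 2 * G)%:E.
Proof.
move=> r0 mu_ ug GE; set k := clamp _.
have lr := ball_left_lt_right x r0; have len := ball_length_le x r.
have G0 : (0 <= G)%R.
  by rewrite -lee_fin -GE; apply: integral_ge0 => z _; exact: sqre_ge0.
have mB := borel_set_measurable_cara (borel_ball x r).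
set l := (ball_right x r - ball_left x r)%R.
have l0 : (0 <= l)%R by rewrite subr_ge0 ltW.
apply: (@le_trans _ _ (\int[cara omega]_(y in ball x r)
    ((l * G)%:E * (coord y `^ (-1))%:E))).
  (* The comparison is made outside the endpoint, a null set at which the oscillation bound says
     nothing. *)
  apply: ae_ge0_le_integral.
  - exact: mB.
  - by move=> y _; rewrite lee_fin sqr_ge0.
  - by apply/measurable_EFinP; apply: measurable_funX; exact: measurable_funB.
  - by move=> y _; rewrite lee_fin mulr_ge0 ?powR_ge0 ?mulr_ge0.
  - apply: measurable_funeM; exact: borel_fun_measurable_cara borel_inv_coord.
  - exists [set y : X | coord y = 0%R]; split.
    + exact: borel_set_measurable_cara borel_coord0.
    + exact: measure_coord0.
    + move=> y /= /not_implyP[xy]; apply: contra_notP => y0.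
      rewrite -EFinM lee_fin; apply: (oscillation_le r0 ug GE xy).
      by rewrite lt_neqAle coord_ge0 andbT eq_sym; apply/eqP.
rewrite ge0_integralZl//; first last.
- by rewrite lee_fin mulr_ge0.
- by move=> y _; rewrite lee_fin powR_ge0.
- exact: borel_fun_measurable_cara borel_inv_coord.
rewrite integral_ball_inv_coord// -EFinM lee_fin mulrAC ler_wpM2r//.
have -> : (4 * r ^+ 2 = (2 * r) * (2 * r))%R by ring.
by rewrite ler_pM.
Qed.

Lemma measure_ball_fin (x : X) (r : R) : (0 < r)%R ->
  exists2 m : R, (0 < m)%R & omega (ball x r) = m%:E.
Proof.
move=> r0; have w0 := full_support_halfline x r0.
have wy : omega (ball x r) < +oo.
  by apply: le_lt_trans (measure_ball_le x r0) _; exact: ltry.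
have wfin : omega (ball x r) \is a fin_num by rewrite ge0_fin_numE// ltW.
exists (fine (omega (ball x r))); last by rewrite fineK.
by rewrite fine_gt0// w0 wy.
Qed.

(** The constant 16 is 4 from passing to the average times 4 from the estimate around the midpoint.
    Measurability of [u] is assumed here because the two applications obtain it differently: from
    local integrability, and from continuity off the endpoint. *)
Lemma sobolev_poincare_measurable (x : X) (r : R) (u : X -> R)
    (g : X -> \bar R) :
  (0 < r)%R -> measurable_on omega (ball x r) u ->
  weak_upper_gradient omega setT u g ->
  \int[cara omega]_(y in ball x r)
    ((u y - average omega u (ball x r)) ^+ 2)%:E <=
  (16 * r ^+ 2)%:E * \int[cara omega]_(y in ball x r) (g y ^+ 2).
Proof.
move=> r0 mu_ ug.
have I0 : 0 <= \int[cara omega]_(y in ball x r) (g y ^+ 2).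
  by apply: integral_ge0 => z _; exact: sqre_ge0.
case GE : (\int[cara omega]_(y in ball x r) (g y ^+ 2)) => [G| |]; last first.
- by move: I0; rewrite GE.
- by rewrite gt0_muley ?leey// lte_fin mulr_gt0// exprn_gt0.
have [m m0 mE] := measure_ball_fin x r0.
have := integral_sqr_sub_average (mu := cara omega)
  (borel_set_measurable_cara (borel_ball x r)) m0 mE mu_
  (poincare_center r0 mu_ ug GE).
rewrite /average mE /= => /le_trans; apply.
by rewrite -EFinM lee_fin le_eqVlt; apply/orP; left; apply/eqP; ring.
Qed.

Lemma poincare_halfline : poincare omega.
Proof.
(* The constant 4 is the square root of 16: Cauchy-Schwarz bounds the mean deviation by the root of
   the mean square deviation. *)
exists 4%R, 1%R; split; [exact: ltr0Sn|exact: lexx|].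
move=> x r u g r0 [mu_ _] ug; cbv zeta; rewrite mul1r.
set B := ball x r.
have muB : measurable_on omega B u by exact: measurable_funTS.
have := sobolev_poincare_measurable r0 muB ug; rewrite -/B.
set J := \int[cara omega]_(y in B) (g y ^+ 2).
have J0 : 0 <= J by apply: integral_ge0 => z _; exact: sqre_ge0.
have [m m0 mE] := measure_ball_fin x r0.
have mB := borel_set_measurable_cara (borel_ball x r).
rewrite mE [fine _]/= => sp.
have mabs : measurable_fun (B : set (caratheodory_type omega))
    (fun y => `|u y - average omega u B|%:E).
  apply/measurable_EFinP.
  apply: measurableT_comp; first exact: normr_measurable.
  by apply: measurable_funB; [exact: muB|exact: measurable_cst].
have I0 : 0 <= \int[cara omega]_(y in B) `|u y - average omega u B|%:E.
  by apply: integral_ge0 => y _; rewrite lee_fin.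
have cs : (\int[cara omega]_(y in B) `|u y - average omega u B|%:E) ^+ 2 <=
    m%:E * ((16 * r ^+ 2)%:E * J).
  apply: le_trans (integral_cauchy_schwarz mB m0 mE mabs _) _.
    by move=> y _; rewrite lee_fin.
  apply: lee_wpmul2l; first by rewrite lee_fin ltW.
  apply: le_trans sp; rewrite le_eqVlt; apply/orP; left; apply/eqP.
  by apply: eq_integral => y _; rewrite -EFin_expe real_normK// num_real.
case: J J0 cs {sp} => [J| |]//; last first.
  move=> _ _; rewrite gt0_muley; last by rewrite lte_fin invr_gt0.
  rewrite poweRyr; last by rewrite gt_eqF.
  by rewrite gt0_muley ?leey// lte_fin mulr_gt0.
rewrite lee_fin => J0.
case: (\int[cara omega]_(y in B) _) I0 => [S| |]//.
rewrite lee_fin -EFin_expe -!EFinM lee_fin => S0 cs.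
have mJ0 : (0 <= m^-1 * J)%R by rewrite mulr_ge0// invr_ge0 ltW.
rewrite lee_fin powR12_sqrt//.
rewrite -(@ler_pXn2r _ 2%N)// ?nnegrE; last 2 first.
- by rewrite mulr_ge0// invr_ge0 ltW.
- by rewrite !mulr_ge0// ?sqrtr_ge0 ?ltW.
rewrite [leRHS]exprMn sqr_sqrtr// -subr_ge0.
have -> : ((4 * r) ^+ 2 * (m^-1 * J) - (m^-1 * S) ^+ 2 =
    (m^-1) ^+ 2 * (m * (16 * r ^+ 2 * J) - S ^+ 2))%R.
  by field; rewrite gt_eqF.
by rewrite mulr_ge0 ?sqr_ge0// subr_ge0.
Qed.

End halfline_poincare.

(** * Continuity off the endpoint and the Sobolev-Poincare inequality *)

Section halfline_sobolev_poincare.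
Local Open Scope ereal_scope.
Context {R : realType}.
Local Notation X := (halfline R).
Local Notation omega := (@halfline_measure R).

(** Short segments near t start to the right of t / 2, so the segment estimate gives |u(t) - u(s)|^2
    <= K |t - s| with K = G / (t / 2): local Hoelder continuity of exponent 1/2. *)
Lemma L2loc_continuous (u : X -> R) (g : X -> \bar R) (t : R) :
  weak_upper_gradient omega setT u g -> L2loc omega g -> (0 < t)%R ->
  {for t, continuous (fun s : R => u (clamp s))}.
Proof.
move=> ug L2g t0; have [rho rho0] := L2g (clamp t).
have I0 : 0 <= \int[cara omega]_(y in ball (clamp t) rho) (g y ^+ 2).
  by apply: integral_ge0 => z _; exact: sqre_ge0.
case GE : (\int[cara omega]_(y in _) _) I0 => [G| |]// I0 _.
rewrite lee_fin in I0.
apply/(@cvgrPdist_lt _ R^o) => e e0.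
pose K := ((t / 2)^-1 * G)%R.
have K0 : (0 <= K)%R by rewrite mulr_ge0// invr_ge0 divr_ge0// ltW.
have K10 : (0 < K + 1)%R by rewrite ltr_wpDl.
have seg a b : (t / 2 < a)%R -> (a < b)%R -> (`|t - a| < rho)%R ->
    (`|t - b| < rho)%R -> ((u (clamp b) - u (clamp a)) ^+ 2 <= (b - a) * K)%R.
  move=> ta ab tar tbr; have t20 : (0 < t / 2)%R by rewrite divr_gt0.
  have a0 : (0 < a)%R by exact: lt_trans ta.
  apply: (@le_trans _ _ ((b - a) / a * G))%R.
    rewrite -lee_fin [leRHS]EFinM -GE.
    apply: (weak_upper_gradient_segment a0 ab (borel_ball (clamp t) rho) _ ug).
    move=> s /andP[as_ sb]; rewrite ballEmdist /=.
    apply: le_lt_trans (mdist_clamp t s) _.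
    move: tar tbr; rewrite !ltr_distl => /andP[? ?] /andP[? ?].
    by apply/andP; split; lra.
  rewrite /K mulrA ler_wpM2r// ler_wpM2l ?subr_ge0 ?(ltW ab)//.
  by rewrite lef_pV2 ?posrE// ltW.
near=> s.
have dt : (`|t - s| < t / 2)%R.
  by near: s; apply: (@cvgr_dist_lt _ R^o) => //; rewrite divr_gt0.
have drho : (`|t - s| < rho)%R.
  by near: s; exact: (@cvgr_dist_lt _ R^o).
(* K + 1 replaces K as divisor because K may be zero. *)
have de : (`|t - s| < e ^+ 2 / (K + 1))%R.
  by near: s; apply: (@cvgr_dist_lt _ R^o) => //; rewrite divr_gt0// exprn_gt0.
have ts2 : (t / 2 < s)%R by move: dt; rewrite ltr_distl => /andP[? ?]; lra.
have : ((u (clamp t) - u (clamp s)) ^+ 2 <= `|t - s| * K)%R.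
  have [st|] := ltP s t.
    rewrite gtr0_norm ?subr_gt0//; apply: seg => //.
    by rewrite subrr normr0.
  rewrite le_eqVlt => /predU1P[<-|ts].
    by rewrite !subrr expr0n normr0 mul0r.
  rewrite distrC gtr0_norm ?subr_gt0// -sqrrN opprB; apply: seg => //.
    by lra.
  by rewrite subrr normr0.
move=> le; rewrite -(@ltr_pXn2r _ 2%N)// ?nnegrE ?(ltW e0)//.
rewrite real_normK ?num_real//; apply: le_lt_trans le _.
apply: (@le_lt_trans _ _ (`|t - s| * (K + 1)))%R; last by rewrite -ltr_pdivlMr.
by rewrite ler_wpM2l// lerDl.
Unshelve. all: by end_near.
Qed.

(** The function [u] composed with [clamp] is constant on ]-oo, 0] and continuous on ]0, +oo[, hence
    Borel; composing with [coord] recovers [u]. *)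
Lemma L2loc_measurable (u : X -> R) (g : X -> \bar R) :
  weak_upper_gradient omega setT u g -> L2loc omega g ->
  measurable_on omega setT u.
Proof.
move=> ug L2g; pose v t := u (clamp t).
have mv : measurable_fun setT v.
  have -> : [set: R] = `]-oo, 0%R] `|` `]0%R, +oo[.
    apply/esym/seteqP; split => // t _ /=.
    by rewrite !in_itv/= andbT; case: leP; [left|right].
  apply/measurable_funU => //; split.
    apply: (eq_measurable_fun (cst (u (clamp 0)))); last exact: measurable_cst.
    move=> t; rewrite inE/= in_itv/= => t0; rewrite /v /=; congr u.
    by apply/val_inj => /=; rewrite maxxx /Num.max ltNge t0.
  apply: open_continuous_measurable_fun; first exact: interval_open.
  move=> t; rewrite inE/= in_itv/= andbT => t0.
  exact: (L2loc_continuous ug L2g t0).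
have -> : u = v \o @coord R by apply/funext => y; rewrite /v /= coordK.
have := measurableT_comp mv measurable_coord.
move=> /measurableT_comp/(_ measurable_borel_cara).
exact.
Qed.

Lemma sobolev_poincare_halfline : sobolev_poincare omega 1.
Proof.
split; first exact: lexx.
exists 16%R; first exact: ltr0Sn.
move=> x r u g r0 _ [ug L2g _]; cbv zeta; rewrite mul1r.
apply: (sobolev_poincare_measurable r0 _ ug).
exact: measurable_funTS (L2loc_measurable ug L2g).
Qed.

End halfline_sobolev_poincare.

(** * Two explicit logarithmic integrals *)

Section ftc.
Context {R : realType}.
Local Notation lambda := (@lebesgue_measure R).

Lemma integral_is_derive (f F : R -> R) (a b : R) : a < b ->
  (forall t, a <= t <= b -> is_derive t 1 F (f t)) ->
  (forall t, a <= t <= b -> {for t, continuous f}) ->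
  (\int[lambda]_(t in `[a, b]) (f t)%:E = (F b - F a)%:E)%E.
Proof.
move=> ab dF cf; rewrite EFinB; apply: continuous_FTC2 => //.
- apply: continuous_in_subspaceT => t; rewrite inE/= in_itv/=; exact: cf.
- have cF t : a <= t <= b -> {for t, continuous F}.
    move=> /dF dFt; apply/differentiable_continuous/derivable1_diffP.
    exact: (@ex_derive _ _ _ _ _ _ _ dFt).
  split.
  + move=> t; rewrite in_itv/= => /andP[at_ tb].
    apply: (@ex_derive _ _ _ _ _ _ _ (dF t _)).
    by rewrite !ltW.
  + by apply: cvg_at_right_filter; apply: cF; rewrite lexx ltW.
  + by apply: cvg_at_left_filter; apply: cF; rewrite lexx ltW.
- move=> t; rewrite in_itv/= => /andP[at_ tb].
  rewrite derive1E.
  by apply: (@derive_val _ _ _ _ _ _ _ (dF t _)); rewrite !ltW.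
Qed.

Lemma one_sub_ln_ge1 (t : R) : t <= 1 -> 1 <= 1 - ln t.
Proof. by move=> t1; rewrite lerBrDr -lerBrDl subrr; exact: ln_le0. Qed.

Let one_sub_ln_gt0 (t : R) : t <= 1 -> 0 < 1 - ln t.
Proof. by move=> /one_sub_ln_ge1; exact: lt_le_trans. Qed.

Let is_derive_one_sub_ln (t : R) : 0 < t ->
  is_derive t 1 (fun s => 1 - ln s) (- t^-1).
Proof.
move=> t0; rewrite -[- _]sub0r.
have -> : (fun s : R => 1 - ln s) = (cst 1 - @ln R : R -> R) by apply/funext.
exact: is_deriveB (is_derive_cst _ _ _) (is_derive1_ln t0).
Qed.

Let continuous_one_sub_ln (t : R) : 0 < t ->
  {for t, continuous (fun s : R => 1 - ln s)}.
Proof.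
by move=> t0; apply: cvgB; [exact: cvg_cst|exact: continuous_ln].
Qed.

(** The antiderivative - ln (1 - ln t) tends to -oo at 0, which makes the density non-integrable
    there. *)
Lemma integral_inv_mul_ln (a b : R) : 0 < a -> a < b -> b <= 1 ->
  (\int[lambda]_(t in `[a, b]) ((t * (1 - ln t))^-1)%:E =
   (ln (1 - ln a) - ln (1 - ln b))%:E)%E.
Proof.
move=> a0 ab b1.
have -> : ln (1 - ln a) - ln (1 - ln b) = - ln (1 - ln b) - - ln (1 - ln a).
  by rewrite opprK addrC.
refine (@integral_is_derive _ (fun t => - ln (1 - ln t)) _ _ ab _ _).
- move=> t /andP[at_ tb]; have t0 : 0 < t by exact: lt_le_trans at_.
  have l0 : 0 < 1 - ln t by apply: one_sub_ln_gt0; exact: le_trans b1.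
  have -> : (t * (1 - ln t))^-1 = - ((1 - ln t)^-1 * - t^-1).
    by rewrite invfM mulrN opprK mulrC.
  exact: is_deriveN (@is_derive1_comp R (@ln R) (fun s => 1 - ln s) t _ _
    (is_derive1_ln l0) (is_derive_one_sub_ln t0)).
- move=> t /andP[at_ tb]; have t0 : 0 < t by exact: lt_le_trans at_.
  have l0 : 0 < 1 - ln t by apply: one_sub_ln_gt0; exact: le_trans b1.
  apply: cvgV; first by rewrite mulf_neq0// gt_eqF.
  by apply: cvgM; [exact: cvg_id|exact: continuous_one_sub_ln].
Qed.

(** The integrand is the squared density times the weight t. Its antiderivative 1 / (1 - ln t) stays
    bounded near 0, so the energy is finite. *)
Lemma integral_inv_mul_sqr_ln (a b : R) : 0 < a -> a < b -> b <= 1 ->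
  (\int[lambda]_(t in `[a, b]) ((t * (1 - ln t) ^+ 2)^-1)%:E =
   ((1 - ln b)^-1 - (1 - ln a)^-1)%:E)%E.
Proof.
move=> a0 ab b1.
refine (@integral_is_derive _ (fun t => (1 - ln t)^-1) _ _ ab _ _).
- move=> t /andP[at_ tb]; have t0 : 0 < t by exact: lt_le_trans at_.
  have l0 : 0 < 1 - ln t by apply: one_sub_ln_gt0; exact: le_trans b1.
  have l_neq0 : 1 - ln t != 0 by rewrite gt_eqF.
  have -> : (t * (1 - ln t) ^+ 2)^-1 = - (1 - ln t) ^- 2 *: (- t^-1 : R^o).
    by rewrite /GRing.scale /= mulrNN invfM mulrC.
  exact: (@is_deriveV R (fun s => 1 - ln s) t _ _ l_neq0
    (is_derive_one_sub_ln t0)).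
- move=> t /andP[at_ tb]; have t0 : 0 < t by exact: lt_le_trans at_.
  have l0 : 0 < 1 - ln t by apply: one_sub_ln_gt0; exact: le_trans b1.
  apply: cvgV; first by rewrite mulf_neq0// ?expf_neq0// gt_eqF.
  apply: cvgM; first exact: cvg_id.
  rewrite expr2; apply: cvgM; exact: continuous_one_sub_ln.
Qed.

End ftc.

(** * The singular density: monotone, of infinite integral and finite energy *)

Section singular_density.
Local Open Scope ereal_scope.
Context {R : realType}.
Local Notation X := (halfline R).
Local Notation lambda := (@lebesgue_measure R).
Local Notation omega := (@halfline_measure R).

(* The value +oo on ]-oo, 0] makes the function nonincreasing on the whole
   line; [powR] is used for the inverse because its measurability is known. *)
Definition singular (t : R) : \bar R :=
  if (t <= 0)%R then +oo else
  if (t <= 1)%R then ((t * (1 - ln t)) `^ (-1))%:E else 0.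

Lemma singular_ge0 t : 0 <= singular t.
Proof.
rewrite /singular; case: ifP => // _; case: ifP => // _.
by rewrite lee_fin powR_ge0.
Qed.

Lemma singularE t : (0 < t <= 1)%R -> singular t = ((t * (1 - ln t))^-1)%:E.
Proof.
move=> /andP[t0 t1]; rewrite /singular leNgt t0/= t1 powR_inv1//.
by rewrite mulr_ge0 ?(ltW t0)// (le_trans _ (one_sub_ln_ge1 t1)).
Qed.

Lemma measurable_singular : measurable_fun setT singular.
Proof.
apply: measurable_fun_ifT; first exact: measurable_fun_ler.
  exact: measurable_cst.
apply: measurable_fun_ifT; first exact: measurable_fun_ler.
  apply/measurable_EFinP; apply: (measurableT_comp (measurable_powR (-1))).
  apply: measurable_funM; first exact: measurable_id.
  by apply: measurable_funB; [exact: measurable_cst|exact: measurable_ln].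
exact: measurable_cst.
Qed.

(** On ]0, 1] the point is that t (1 - ln t) is nondecreasing: its increment from s to t is
    [(t - s) - s (ln t - ln s)] + (t - s) (- ln t), a sum of two nonnegative terms. *)
Lemma singular_nonincreasing s t : (s <= t)%R -> singular t <= singular s.
Proof.
move=> st; have [s0|s0] := leP s 0%R; first by rewrite {2}/singular s0 leey.
have t0 : (0 < t)%R by exact: lt_le_trans st.
have [t1|t1] := leP t 1%R; last first.
  have -> : singular t = 0 by rewrite /singular !leNgt t0 t1.
  exact: singular_ge0.
have s1 : (s <= 1)%R by exact: le_trans t1.
have ls := one_sub_ln_ge1 s1; have lt := one_sub_ln_ge1 t1.
(* This is ln (1 + x) <= x at x = t / s - 1, multiplied by s. *)
have key : (s * (ln t - ln s) <= t - s)%R.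
  have h : (ln (t / s) <= t / s - 1)%R.
    have := @le_ln1Dx R (t / s - 1)%R; rewrite subrKC; apply.
    by rewrite ltrBrDl addrN divr_gt0.
  rewrite ln_div ?posrE// in h.
  apply: le_trans (ler_wpM2l (ltW s0) h) _.
  by rewrite mulrBr mulr1 mulrC divfK// gt_eqF.
rewrite !singularE ?s0 ?t0// lee_fin lef_pV2 ?posrE ?mulr_gt0//; try lra.
have : (0 <= (t - s) * - ln t)%R.
  by rewrite mulr_ge0 ?subr_ge0// oppr_ge0 ln_le0.
by lra.
Qed.

Lemma integral_singular (L : R) : (0 < L)%R ->
  \int[lambda]_(t in `[0%R, L]) singular t = +oo.
Proof.
move=> L0; pose c := Num.min L 1%R.
have c0 : (0 < c)%R by rewrite lt_min L0 ltr01.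
have c1 : (c <= 1)%R by rewrite ge_min lexx orbT.
have cL : (c <= L)%R by rewrite ge_min lexx.
have lc : (0 < 1 - ln c)%R by exact: lt_le_trans (one_sub_ln_ge1 c1).
apply/eqyP => M M0.
(* The point d solves ln (1 - ln d) - ln (1 - ln c) = M, so the integral over [d, c] is exactly
   M. *)
pose d : R := expR (1 - expR (M + ln (1 - ln c))).
have d0 : (0 < d)%R by exact: expR_gt0.
have lnd : ln (1 - ln d)%R = (M + ln (1 - ln c))%R.
  by rewrite /d expRK opprB addrC subrK expRK.
have dc : (d < c)%R.
  rewrite -ltr_ln ?posrE// /d expRK -{2}[ln c](subKr 1%R) ltrD2l ltrN2.
  by rewrite -[ltLHS]lnK ?posrE// ltr_expR ltrDr.
apply: (@le_trans _ _ (\int[lambda]_(t in `[d, c]) singular t)).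
  have -> : \int[lambda]_(t in `[d, c]) singular t =
      \int[lambda]_(t in `[d, c]) ((t * (1 - ln t))^-1)%:E.
    apply: eq_integral => t; rewrite inE/= in_itv/= => /andP[dt tc].
    by apply: singularE; rewrite (lt_le_trans d0 dt) (le_trans tc).
  by rewrite integral_inv_mul_ln// lnd addrK lexx.
apply: ge0_subset_integral => //=.
- exact: measurable_funTS measurable_singular.
- by move=> t _; exact: singular_ge0.
- by apply: subset_itv; rewrite bnd_simp// ltW.
Qed.

Definition singular_halfline (y : X) : \bar R := singular (coord y).

Lemma borel_singular_halfline : borel_fun singular_halfline.
Proof. exact: (measurableT_comp measurable_singular measurable_coord). Qed.

(** The interval ]0, 1] is exhausted by compact intervals, on each of which the explicit formula
    gives at most 1. *)
Lemma integral_sqr_singular :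
  \int[cara omega]_y (singular_halfline y ^+ 2) < +oo.
Proof.
rewrite (integral_cara_halfline
  (@measurableT _ (g_sigma_algebraType (@open X)))); last 2 first.
- exact: (emeasurable_funM borel_singular_halfline borel_singular_halfline).
- by move=> y; exact: sqre_ge0.
rewrite preimage_setT.
pose f (t : R) := singular t ^+ 2 * (weight t)%:E.
have mf : measurable_fun setT f.
  apply: emeasurable_funM.
    exact: (emeasurable_funM measurable_singular measurable_singular).
  by apply/measurable_EFinP; exact: measurable_weight.
have f0 t : 0 <= f t by rewrite mule_ge0 ?sqre_ge0// lee_fin weight_ge0.
(* Starting at 1 / 2 keeps the left end strictly below 1, as the explicit integral requires. *)
pose F (n : nat) := `[(n.+2%:R^-1)%R, 1%R]%classic : set R.
have FE : \bigcup_n F n = `]0%R, 1%R]%classic.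
  apply/seteqP; split => t /=.
    move=> [n _]; rewrite /F /= !in_itv/= => /andP[nt ->].
    by rewrite (lt_le_trans _ nt).
  rewrite in_itv/= => /andP[t0 t1].
  exists (Num.truncn t^-1) => //; rewrite /F /= in_itv/= t1 andbT.
  rewrite -[leRHS]invrK lef_pV2 ?posrE ?invr_gt0// ltW//.
  by rewrite (lt_trans (truncnS_gt _))// ltr_nat.
have nF : nondecreasing_seq F.
  move=> n m nm; rewrite subsetEset; apply: subset_itvr; rewrite bnd_simp.
  by rewrite lef_pV2 ?posrE// ler_nat.
have -> : \int[lambda]_t (singular_halfline (clamp t) ^+ 2 * (weight t)%:E) =
    \int[lambda]_(t in \bigcup_n F n) f t.
  rewrite FE [RHS]integral_mkcond; apply: eq_integral => t _; rewrite patchE.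
  (* For t <= 0 the density is infinite and the weight zero; the convention that their product is 0
     removes this part. *)
  have [t0|t0] := leP t 0%R.
    by rewrite weight_le0// mule0 /f weight_le0// mule0 if_same.
  rewrite /singular_halfline clampK; last exact: ltW.
  case: ifPn => //; rewrite notin_setE /= in_itv/= t0/= => /negP.
  rewrite -ltNge => t1.
  by rewrite (_ : singular t = 0) ?mul0e// /singular !leNgt t0 t1.
have cv : \int[lambda]_(t in F n) f t @[n --> \oo] -->
    \int[lambda]_(t in \bigcup_n F n) f t.
  apply: ge0_nondecreasing_set_cvg_integral => //.
    by move=> n; exact: measurable_itv.
  by move=> n; exact: measurable_funTS mf.
rewrite -(cvg_lim _ cv)//.
apply: (@le_lt_trans _ _ 1); last exact: ltry.
apply: lime_le; first by apply/cvg_ex; eexists; exact: cv.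
apply: nearW => n.
have n0 : (0 < n.+2%:R^-1 :> R)%R by [].
have n1 : (n.+2%:R^-1 < 1 :> R)%R by rewrite invf_lt1// ltr1n.
have -> : \int[lambda]_(t in F n) f t =
    \int[lambda]_(t in F n) ((t * (1 - ln t) ^+ 2)^-1)%:E.
  apply: eq_integral => t; rewrite inE /F /= in_itv/= => /andP[nt t1].
  have t0 : (0 < t)%R by exact: lt_le_trans nt.
  rewrite /f singularE ?t0// weight_gt0// -EFin_expe -EFinM; congr (_%:E).
  have := one_sub_ln_ge1 t1; move=> l1; field.
  by rewrite !gt_eqF//; lra.
rewrite integral_inv_mul_sqr_ln// ln1 subr0 invr1 lee_fin gerBl invr_ge0.
by apply: le_trans (one_sub_ln_ge1 (ltW n1)).
Qed.

End singular_density.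

(** * Zero capacity and positive content of the endpoint *)

Section capacity_of_the_endpoint.
Local Open Scope ereal_scope.

(** The integral of a nonnegative function is a supremum over the simple functions below it, hence
    monotone for arbitrary functions. It will be applied to a density composed with a curve. *)
Lemma ge0_le_integral_unmeasurable d (T : measurableType d) (R : realType)
    (mu : {measure set T -> \bar R}) (D : set T) (f h : T -> \bar R) :
  (forall x, D x -> 0 <= f x) -> (forall x, D x -> f x <= h x) ->
  \int[mu]_(x in D) f x <= \int[mu]_(x in D) h x.
Proof.
move=> f0 fh; rewrite (integral_mkcond D f) (integral_mkcond D h).
have fD0 x : 0 <= (f \_ D) x by apply: erestrict_ge0.
have fhD x : (f \_ D) x <= (h \_ D) x.
  by rewrite !patchE; case: ifPn => //; rewrite inE; exact: fh.
rewrite !ge0_integralTE//; last by move=> x; exact: le_trans (fhD x).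
apply: ge_ereal_sup => _ [k kf <-]; apply: ereal_sup_ubound.
by exists k => // x; exact: le_trans (fhD x).
Qed.

(** The chord is the sum for the partition without interior points, so the length t - s dominates
    it. *)
Lemma curve_lipschitz (R : realType) (X : pointedMetricType R) (c : curve X)
    (s t : R) : (0 <= s)%R -> (s <= t)%R -> (t <= curve_len c)%R ->
  (mdist (c s) (c t) <= t - s)%R.
Proof.
move=> s0; rewrite le_eqVlt => /predU1P[->|st] tc.
  by rewrite mdistxx subrr.
rewrite -lee_fin -(curve_arc_length s0 (ltW st) tc).
apply: ereal_sup_ubound => /=; exists [:: t]; first exact: itv_partition1.
by rewrite big_nat1.
Qed.

Context {R : realType}.
Local Notation X := (halfline R).
Local Notation lambda := (@lebesgue_measure R).
Local Notation omega := (@halfline_measure R).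

Local Notation oppR := (-%R : measurableTypeR R -> measurableTypeR R).

(** The reflection is a sign change followed by a translation, both preserving Lebesgue measure. It
    serves the curves that end, rather than start, at the endpoint. *)
Lemma integral_singular_reflection (L : R) : (0 < L)%R ->
  \int[lambda]_(t in `[0%R, L]) singular (L - t) = +oo.
Proof.
move=> L0; have mf : measurable_fun setT (fun t : R => singular (L + t)).
  exact: (measurableT_comp measurable_singular (measurable_addl L)).
have mN : measurable_fun setT oppR by exact: oppr_measurable.
transitivity (\int[pushforward lambda oppR]_(t in `[(- L)%R, 0%R])
    singular (L + t)).
  rewrite (ge0_integral_pushforward mN)//; last 2 first.
  - exact: measurable_funTS mf.
  - by move=> t _; exact: singular_ge0.
  congr (integral _ _ _); apply/seteqP; split => t /=.
    by rewrite !in_itv/= => /andP[? ?]; apply/andP; split; lra.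
  by rewrite !in_itv/= => /andP[? ?]; apply/andP; split; lra.
transitivity (\int[lambda]_(t in `[(- L)%R, 0%R]) singular (L + t)).
  by apply: eq_measure_integral => A mA _; exact: lebesgue_measureN.
rewrite (ge0_integral_translation L (- L)%R 0%R measurable_singular)//.
  by rewrite subrr addr0 integral_singular.
exact: singular_ge0.
Qed.

Lemma path_integral_singular (e : R) (c : curve X) : (0 < e)%R ->
  coord (c 0%R) = 0%R \/ coord (c (curve_len c)) = 0%R ->
  path_integral (fun y => e%:E * singular_halfline y) c = +oo.
Proof.
move=> e0; have L0 := curve_len_gt0 c; set L := curve_len c.
(* A bound [coord (c t)] <= f t is turned by monotonicity into a lower bound for the density along
   the curve; f will be t or L - t according to which end of the curve is at 0. *)
have infty (f : R -> R) : measurable_fun setT f ->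
    \int[lambda]_(t in `[0%R, L]) singular (f t) = +oo ->
    (forall t, (0 <= t <= L)%R -> coord (c t) <= f t)%R ->
    path_integral (fun y => e%:E * singular_halfline y) c = +oo.
  move=> mf foo cf; apply/eqP; rewrite -leye_eq.
  apply: (@le_trans _ _
      (\int[lambda]_(t in `[0%R, L]) (e%:E * singular (f t)))).
    rewrite ge0_integralZl//=.
    - by rewrite foo gt0_muley ?lexx// lte_fin.
    - exact: measurable_funTS (measurableT_comp measurable_singular mf).
    - by move=> t _; exact: singular_ge0.
    - by rewrite lee_fin ltW.
  apply: ge0_le_integral_unmeasurable => t; rewrite /= in_itv/= => tL.
    by rewrite mule_ge0 ?singular_ge0// lee_fin ltW.
  apply: lee_wpmul2l; first by rewrite lee_fin ltW.
  by apply: singular_nonincreasing; exact: cf.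
case=> c0.
  apply: (infty id); first exact: measurable_id.
    exact: integral_singular.
  move=> t /andP[t0 tL]; have := curve_lipschitz (lexx 0%R) t0 tL.
  by rewrite mdist_halfline c0 sub0r normrN subr0 ger0_norm// coord_ge0.
apply: (infty (fun t => L - t)%R); first exact: measurable_funB.
  exact: integral_singular_reflection.
move=> t /andP[t0 tL]; have := curve_lipschitz t0 tL (lexx _).
by rewrite mdist_halfline c0 subr0 ger0_norm// coord_ge0.
Qed.

Lemma modulus_set0 : modulus omega set0 = 0.
Proof.
apply/eqP; rewrite eq_le; apply/andP; split; last first.
  apply: le_ereal_inf_tmp => _ [rho _ <-].
  by apply: integral_ge0 => y _; exact: sqre_ge0.
apply: ereal_inf_lbound; exists (cst 0).
  by split=> //; exact: measurable_cst.
by apply: integral0_eq => y _; rewrite expe2 mule0.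
Qed.

(** When the inequality holds on all curves, the exceptional family is empty. *)
Lemma upper_gradient_weak (U : set X) (u : X -> R) (g : X -> \bar R) :
  borel_fun g -> (forall y, 0 <= g y) ->
  (forall c : curve X,
    `|u (c (curve_len c)) - u (c 0%R)|%:E <= path_integral g c) ->
  weak_upper_gradient omega U u g.
Proof.
move=> bg g0 ug; split => //; rewrite -modulus_set0; congr modulus.
by apply/seteqP; split => // c [_ /=]; apply; exact: ug.
Qed.

Lemma weak_upper_gradient0 (U : set X) :
  weak_upper_gradient omega U (cst 0%R) (cst 0).
Proof.
apply: upper_gradient_weak => //; first exact: measurable_cst.
by move=> c; rewrite subrr normr0; exact: integral_ge0.
Qed.

Lemma integral_sqre_cst0 (D : set X) :
  \int[cara omega]_(y in D) ((cst 0 : X -> \bar R) y ^+ 2) = 0.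
Proof. by apply: integral0_eq => y _; rewrite expe2 mule0. Qed.

Lemma integral_sqrr_cst0 (D : set X) :
  \int[cara omega]_(y in D) ((cst 0%R : X -> R) y ^+ 2)%:E = 0.
Proof. by apply: integral0_eq => y _; rewrite expr0n. Qed.

Lemma N12_cst0 (U : set X) : N12 omega U (cst 0%R).
Proof.
split; first exact: measurable_cst.
  by rewrite integral_sqrr_cst0.
by exists (cst 0); [exact: weak_upper_gradient0|rewrite integral_sqre_cst0].
Qed.

Lemma sobolev_capacity_ge0 (E : set X) : 0 <= sobolev_capacity omega E.
Proof.
apply: le_ereal_inf_tmp => _ [u [g [_ _ _ ->]]].
apply: adde_ge0; apply: integral_ge0 => y _.
  by rewrite lee_fin sqr_ge0.
exact: sqre_ge0.
Qed.

Lemma sobolev_capacity_set0 : sobolev_capacity omega set0 = 0.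
Proof.
apply/eqP; rewrite eq_le sobolev_capacity_ge0 andbT.
apply: ereal_inf_lbound; exists (cst 0%R), (cst 0); split => //.
- exact: N12_cst0.
- exact: weak_upper_gradient0.
- apply/esym; rewrite -[RHS]adde0.
  by congr (_ + _); [exact: integral_sqrr_cst0|exact: integral_sqre_cst0].
Qed.

Definition endpoint_indic (y : X) : R := (coord y == 0%R)%:R.

(** If one end of a curve is at 0 the path integral is infinite; otherwise the indicator vanishes at
    both ends. A passage through 0 in between leaves the difference of end values at zero. *)
Lemma endpoint_indic_weak_upper_gradient (e : R) : (0 < e)%R ->
  weak_upper_gradient omega setT endpoint_indic
    (fun y => e%:E * singular_halfline y).
Proof.
move=> e0; have g0 y : 0 <= e%:E * singular_halfline y.
  by rewrite mule_ge0 ?singular_ge0// lee_fin ltW.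
apply: upper_gradient_weak => //.
  exact: measurable_funeM borel_singular_halfline.
move=> c; rewrite /endpoint_indic.
have [cL|cL] := eqVneq (coord (c (curve_len c))) 0%R.
  by rewrite path_integral_singular ?leey//; right.
have [c0|c0] := eqVneq (coord (c 0%R)) 0%R.
  by rewrite path_integral_singular ?leey//; left.
by rewrite subrr normr0; exact: integral_ge0.
Qed.

Lemma integral_sqr_endpoint_indic :
  \int[cara omega]_y (endpoint_indic y ^+ 2)%:E = 0.
Proof.
have -> : (fun y : X => (endpoint_indic y ^+ 2)%:E) =
    (fun y => (\1_[set z : X | coord z = 0%R] y)%:E).
  apply/funext => y; rewrite /endpoint_indic indicE; congr (_%:E).
  rewrite (_ : (y \in _) = (coord y == 0%R)).
    by case: eqP => _; rewrite ?expr1n ?expr0n.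
  by apply/idP/eqP; rewrite inE.
rewrite integral_indic; last 2 first.
- exact: measurableT.
- exact: borel_set_measurable_cara borel_coord0.
by rewrite setIT; exact: measure_coord0.
Qed.

Lemma integral_sqr_scaled_singular (e : R) :
  \int[cara omega]_y ((e%:E * singular_halfline y) ^+ 2) =
  (e ^+ 2)%:E * \int[cara omega]_y (singular_halfline y ^+ 2).
Proof.
rewrite -ge0_integralZl; last 4 first.
- exact: measurableT.
- apply: borel_fun_measurable_cara.
  exact: (emeasurable_funM borel_singular_halfline borel_singular_halfline).
- by move=> y _; exact: sqre_ge0.
- by rewrite lee_fin sqr_ge0.
by apply: eq_integral => y _; rewrite !expe2 muleACA -EFinM -expr2.
Qed.

Lemma N12_endpoint_indic : N12 omega setT endpoint_indic.
Proof.
split.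
- have m0 : measurable_fun setT (fun t : R => (t == 0%R)%:R : R).
    have -> : (fun t : R => (t == 0%R)%:R : R) = \1_[set 0%R].
      apply/funext => t; rewrite indicE; congr (_%:R); congr nat_of_bool.
      by apply/eqP/idP; rewrite inE.
    exact: measurable_indic.
  have mc := measurableT_comp m0 measurable_coord.
  exact: (measurableT_comp mc measurable_borel_cara).
- by rewrite integral_sqr_endpoint_indic.
- exists (fun y => 1%:E * singular_halfline y).
    exact: endpoint_indic_weak_upper_gradient.
  rewrite integral_sqr_scaled_singular expr1n mul1e.
  exact: integral_sqr_singular.
Qed.

Lemma sobolev_capacity_endpoint :
  sobolev_capacity omega [set clamp 0%R : X] = 0.
Proof.
apply/eqP; rewrite eq_le sobolev_capacity_ge0 andbT.
have J0 : 0 <= \int[cara omega]_y (singular_halfline y ^+ 2).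
  by apply: integral_ge0 => y _; exact: sqre_ge0.
have := @integral_sqr_singular R.
case JE : (\int[cara omega]_y _) J0 => [J| |]//; rewrite lee_fin => J0 _.
apply/lee_addgt0Pr => d d0; rewrite add0e.
have J10 : (0 < J + 1)%R by rewrite ltr_wpDl.
(* Chosen so that the energy e^2 J = d J / (J + 1) is at most d; J + 1 keeps the divisor
   positive. *)
pose e := Num.sqrt (d / (J + 1))%R.
have e0 : (0 < e)%R by rewrite sqrtr_gt0 divr_gt0.
apply: (@le_trans _ _ (\int[cara omega]_y (endpoint_indic y ^+ 2)%:E +
    \int[cara omega]_y ((e%:E * singular_halfline y) ^+ 2))).
  apply: ereal_inf_lbound.
  exists endpoint_indic, (fun y => e%:E * singular_halfline y); split => //.
  - exact: N12_endpoint_indic.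
  - exact: endpoint_indic_weak_upper_gradient.
  - by move=> y ->; rewrite /endpoint_indic clampK// eqxx.
rewrite integral_sqr_endpoint_indic add0e integral_sqr_scaled_singular JE.
rewrite -EFinM lee_fin.
rewrite sqr_sqrtr; last by rewrite divr_ge0 ?ltW.
by rewrite mulrAC ler_pdivrMr// ler_wpM2l ?(ltW d0)// lerDl.
Qed.

Lemma capacity_endpoint (Omega : set X) :
  capacity omega [set clamp 0%R : X] Omega = 0.
Proof.
apply/eqP; rewrite eq_le; apply/andP; split; last first.
  apply: le_ereal_inf_tmp => _ [v [w [g [_ _ _ _ ->]]]].
  by apply: integral_ge0 => y _; exact: sqre_ge0.
apply: ereal_inf_lbound; exists (cst 0%R), (cst 0%R), (cst 0); split.
- by split => //; exact: N12_cst0.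
- split; last exact: aeW.
  move=> e e0; exists set0; split; first exact: open0.
    by rewrite sobolev_capacity_set0 lte_fin.
  by move=> y; exact: cvg_cst.
(* For the zero function the set where the bound 1 <= w fails is the whole of {0}, which has zero
   Sobolev capacity. *)
- rewrite /quasieverywhere_on -sobolev_capacity_endpoint.
  congr sobolev_capacity.
  apply/seteqP; split => [y []//|y /= ->].
  by split => //; apply/negP; rewrite ler10.
- split; first exact: weak_upper_gradient0.
    by move=> y; exists 1%R => //; rewrite integral_sqre_cst0.
  by move=> g [_ g0 _] _; exact: aeW.
- by rewrite integral_sqre_cst0.
Qed.

(** The one ball containing the endpoint already contributes at least 1/4, for (c + r) r / 4 divided
    by r^2 is 1/4 + c / (4 r), with c >= 0 the coordinate of its centre. *)
Lemma codim_content_endpoint :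
  0 < codim_content omega [set clamp 0%R : X] (clamp 0%R) 1.
Proof.
apply: (@lt_le_trans _ _ (4^-1)%:E); first by rewrite lte_fin.
apply: le_ereal_inf_tmp => _ [D [c [r [cr cov ->]]]].
have [i Di ci0] := cov (clamp 0%R) erefl.
have [_ /andP[ri0 _]] := cr i Di.
apply: esum_ge; exists [set i]; first by split => // _ ->.
rewrite fsbig_set1.
apply: (@le_trans _ _
    (((coord (c i) + r i) * r i / 4)%:E * ((r i ^+ 2)^-1)%:E)).
  rewrite -EFinM lee_fin.
  have -> : ((coord (c i) + r i) * r i / 4 * (r i ^+ 2)^-1 =
      4^-1 + 4^-1 * (coord (c i) / r i))%R by field; rewrite gt_eqF.
  by rewrite lerDl mulr_ge0// divr_ge0 ?coord_ge0// ltW.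
apply: lee_wpmul2r; first by rewrite lee_fin invr_ge0 sqr_ge0.
exact: measure_ball_ge.
Qed.

End capacity_of_the_endpoint.

(** * The half-line with its endpoint as the example *)

Theorem proposition3p10 (R : realType) :
  exists (X : completeMetricType R) (omega : {outer_measure set X -> \bar R})
         (x0 : X) (r0 : R) (K : set X),
    [/\ unbounded_space X,
        PI_space omega,
        0 < r0 /\ compact K /\ K `<=` ball x0 r0,
        (0 < codim_content omega K x0 r0)%E
      & (exists lambda2 : R, sobolev_poincare omega lambda2) /\
        (forall lambda2 Lambda0 : R,
           sobolev_poincare omega lambda2 -> 8 * lambda2 + 8 < Lambda0 ->
           capacity omega K (ball x0 (Lambda0 * r0)) = 0%E)].
Proof.
exists (halfline R), halfline_measure, (clamp 0), 1, [set clamp 0]; split.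
- move=> M; exists (clamp 0), (clamp (`|M| + 1)).
  rewrite mdist_halfline !clampK ?addr_ge0// sub0r normrN ger0_norm ?addr_ge0//.
  by rewrite (le_lt_trans (ler_norm M))// ltrDl.
- split; [exact: borel_regular_halfline|exact: full_support_halfline
         |exact: doubling_halfline|exact: poincare_halfline].
- split; first exact: ltr01.
  split; first exact: compact_set1.
  by move=> y ->; exact: ballxx.
- exact: codim_content_endpoint.
- split; first by exists 1; exact: sobolev_poincare_halfline.
  by move=> lambda2 Lambda0 _ _; exact: capacity_endpoint.
Qed.
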